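(* Let $A$ and $B$ be two unbounded normal operators on a Hilbert space $H$ obeying $AB^*=B^*A$. Assume that $B$ is invertible (the invertibility of $A$ is not assumed). Let $D$ be a dense linear manifold contained in the domains of $A^*A$, $B^*A$, $A^*B$ and $B^*B$. Then $A+B$ is essentially normal on $D$ if $D$ is a core for $(A+B)^*(A+B)$.
   Context: Operators are linear and not necessarily bounded (''unbounded'' means not necessarily bounded). Sums and products carry their natural domains: $D(A+B)=D(A)\cap D(B)$ and $D(AB)=\{x\in D(B): Bx\in D(A)\}$; equality of operators includes equality of domains. A densely defined closed operator $N$ is normal if $NN^*=N^*N$. Invertible means having an everywhere defined bounded inverse, i.e. $B^{-1}\in B(H)$. A densely defined closable operator $T$ is essentially normal if its closure $\overline{T}$ is normal; it is essentially normal on $D\subset D(T)$ if the restriction $T|_D$ is essentially normal. A linear subspace $D\subset D(T)$ is a core for a closable operator $T$ if the closure of the restriction $T|_D$ equals the closure of $T$. *)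

(* Defs.v *)
From HB Require Import structures.
From mathcomp Require Import all_boot all_order all_algebra.
From mathcomp Require Import sesquilinear complex.
From mathcomp Require Import all_classical all_reals all_analysis.
Import Order.TTheory GRing.Theory Num.Theory.
Import numFieldNormedType.Exports.

Set Implicit Arguments.
Unset Strict Implicit.
Unset Printing Implicit Defensive.

Local Open Scope classical_set_scope.
Local Open Scope complex_scope.
Local Open Scope ring_scope.

(* The form is linear in its first argument, conjugate-linear in its second. *)
Record hilbertType (R : realType) := HilbertType {
  hilbert_sort :> completeNormedModType R[i];
  inner : {dot hilbert_sort for Num.conj};
  inner_norm : forall x : hilbert_sort, inner x x = `|x| ^+ 2
}.

Definition linear_subspace (K : numFieldType) (V : lmodType K) (S : set V) : Prop :=
  GRing.submod_closed (mem S).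

(* An operator is given by its graph, a set of pairs (x, T x) in H * H, so that
   Leibniz equality of graphs is equality of operators, domains included. The
   operations below make sense for arbitrary sets of pairs; is_operator singles
   out the graphs of linear maps defined on a linear subspace. *)
Section Operators.
Context {R : realType} {H : hilbertType R}.
Implicit Types (S T : set (H * H)) (D : set H).

Definition dom T : set H := fst @` T.

Definition is_operator T : Prop :=
  linear_subspace T /\ forall x y z, T (x, y) -> T (x, z) -> y = z.

Definition densely_defined T : Prop := dense (dom T).

Definition add_op S T : set (H * H) :=
  [set p | exists y z, [/\ S (p.1, y), T (p.1, z) & p.2 = y + z]].

Definition comp_op S T : set (H * H) :=
  [set p | exists2 y, T (p.1, y) & S (y, p.2)].

(* This is the graph of an operator only when T is densely defined. *)
Definition adj T : set (H * H) :=
  [set p | forall x y, T (x, y) -> inner H y p.1 = inner H x p.2].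

Definition restr_op T D : set (H * H) := [set p | T p /\ D p.1].

Definition closable T : Prop := is_operator (closure T).

Definition invertible T : Prop :=
  exists f : {linear H -> H},
    (exists M : R, forall x, `|f x| <= M%:C * `|x|) /\
    (T^-1)%relation = [set p | p.2 = f p.1].

Definition normal_op T : Prop :=
  [/\ is_operator T, densely_defined T, closed T &
      comp_op T (adj T) = comp_op (adj T) T].

Definition essentially_normal T : Prop :=
  [/\ is_operator T, densely_defined T, closable T & normal_op (closure T)].

Definition essentially_normal_on T D : Prop :=
  [/\ linear_subspace D, D `<=` dom T & essentially_normal (restr_op T D)].

Definition is_core T D : Prop :=
  [/\ is_operator T, closable T, linear_subspace D, D `<=` dom T &
      closure (restr_op T D) = closure T].

End Operators.

(* Main.v *)
Require Import Defs.
From mathcomp Require Import all_boot all_order all_algebra.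
From mathcomp Require Import separable cyclic cyclotomic.
From mathcomp Require Import sesquilinear complex.
From mathcomp Require Import all_classical all_reals all_analysis.
From mathcomp Require Import ring lra zify.
Import Order.TTheory GRing.Theory Num.Theory.
Import numFieldNormedType.Exports.

(** Write S for A + B, C for the inverse of B, and X' for the adjoint of an
    operator X.

    On D the four products that make up S'S can be reordered: A'A = AA' and
    B'B = BB' by normality, B'A = AB' by hypothesis, and A'B is contained in BA'
    because B has a bounded inverse. So S' maps D into the domain of S, with
    SS' = S'S on D, and |S u| = |S' u| there ([sum_on_D]). Suppose now that no
    nonzero vector is orthogonal to all u + S'S u with u in D. An element of the
    graph of the biadjoint of S, or of S', that is orthogonal to the graph of
    the restriction to D is then zero, so D is a core for both operators
    ([closure_sum_on_D], [closure_adj_on_D]). By the equality of norms on D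
    their closures have the same domain and the same norms, and this is
    normality ([normal_of_isometric]).

    There remains the totality of the range of 1 + S'S on D. Since D is a core
    for S'S, the domain of S'S may be used instead of D
    ([range_on_D_total]). Note that S need not be closed, so totality
    is not a general fact about S'S. Let J be the inverse of 1 + A'A and
    Q = J C C'. This bounded operator is selfadjoint and injective, maps H into
    the domain of S'S, and commutes with S. If y is orthogonal to the range of
    1 + S'S, then, with z = Q y,
      0 = (Q z + S'S Q z, y) = (z + S'S z, z) = |z|^2 + |S z|^2,
    whence y = 0 ([total_of_resolvent]).

    The properties of Q require C to commute with J, whereas the hypothesis
    only gives that C' commutes with A: this is Fuglede's theorem
    ([inverse_resolvent_comm]). It is obtained without spectral theory. A
    map L bounded by c and commuting with A has all its conjugates
    J^-n L J^n bounded by c ([conjugate_resolvent]). Consequently C is bounded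
    for the forms of all J^j ([resolvent_power_bound]), and
    (1 + aJ)^n C (1 - aJ)^n is bounded by a constant times (1 + |a|^2)^n for
    every complex a. This is a polynomial in a whose linear coefficient is
    n (J C - C J); Cauchy's estimate with |a|^2 = 1/n and n large shows that it
    vanishes ([resolvent_commutes]).

    Resolvents, biadjoints and cores all come from the orthogonal projection
    onto a closed subspace of the Hilbert sum of two copies of H
    ([projection]). *)

Set Implicit Arguments.
Unset Strict Implicit.
Unset Printing Implicit Defensive.

Local Open Scope classical_set_scope.
Local Open Scope complex_scope.
Local Open Scope ring_scope.

(** * Squared norms and the topology of a Hilbert space *)

Section Hilbert.
Context {R : realType} {H : hilbertType R}.
Implicit Types (x y z : H) (a : R[i]) (r e : R).

Local Notation ip := (inner H).

(** Estimates are done in R with real parts of inner products and with squared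
    norms; the latter never require a square root. *)
Definition re x y : R := complex.Re (ip x y).
Definition sq x : R := re x x.

Lemma ipDl x y z : ip (x + y) z = ip x z + ip y z. Proof. exact: linearDl. Qed.
Lemma ipDr x y z : ip z (x + y) = ip z x + ip z y. Proof. exact: linearDr. Qed.
Lemma ipBl x y z : ip (x - y) z = ip x z - ip y z. Proof. exact: linearBl. Qed.
Lemma ipBr x y z : ip z (x - y) = ip z x - ip z y. Proof. exact: linearBr. Qed.
Lemma ip0l z : ip 0 z = 0. Proof. exact: linear0l. Qed.
Lemma ip0r z : ip z 0 = 0. Proof. exact: linear0r. Qed.
Lemma ipZl a x y : ip (a *: x) y = a * ip x y. Proof. exact: linearZl_LR. Qed.
Lemma ipZr a x y : ip x (a *: y) = a^* * ip x y. Proof. exact: linearZr_LR. Qed.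
Lemma ipC x y : ip y x = (ip x y)^*.
Proof. by rewrite hermC /= expr0 mul1r. Qed.

Lemma reC x y : re x y = re y x.
Proof. by rewrite /re (ipC x y); case: (ip x y). Qed.
Lemma reDl x y z : re (x + y) z = re x z + re y z.
Proof. by rewrite /re ipDl raddfD. Qed.
Lemma reDr x y z : re z (x + y) = re z x + re z y.
Proof. by rewrite /re ipDr raddfD. Qed.
Lemma reBl x y z : re (x - y) z = re x z - re y z.
Proof. by rewrite /re ipBl raddfB. Qed.
Lemma reBr x y z : re z (x - y) = re z x - re z y.
Proof. by rewrite /re ipBr raddfB. Qed.
Lemma reZl r x y : re (r%:C *: x) y = r * re x y.
Proof. by rewrite /re ipZl; case: (ip x y) => u v /=; rewrite mul0r subr0. Qed.
Lemma reZr r x y : re x (r%:C *: y) = r * re x y.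
Proof. by rewrite reC reZl reC. Qed.
Lemma re0l x : re 0 x = 0. Proof. by rewrite /re ip0l. Qed.
Lemma re0r x : re x 0 = 0. Proof. by rewrite /re ip0r. Qed.
Lemma reNl x y : re (- x) y = - re x y.
Proof. by rewrite -sub0r reBl re0l sub0r. Qed.
Lemma reNr x y : re x (- y) = - re x y.
Proof. by rewrite reC reNl reC. Qed.

Lemma im_re x y : complex.Im (ip x y) = re x ('i *: y).
Proof. by rewrite /re ipZr; case: (ip x y) => u v /=; ring. Qed.

Lemma ip_sq x : ip x x = (sq x)%:C.
Proof.
have := ipC x x; rewrite /sq /re; case: (ip x x) => u v [] /= h.
by congr (_ +i* _); lra.
Qed.

Lemma sq_norm x : (sq x)%:C = `|x| ^+ 2.
Proof. by rewrite -ip_sq inner_norm. Qed.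

Lemma sq_ge0 x : 0 <= sq x.
Proof. by rewrite -ler0c sq_norm exprn_ge0. Qed.

Lemma sq_eq0 x : sq x = 0 -> x = 0.
Proof.
move=> h; have /esym/eqP := sq_norm x.
by rewrite h expf_eq0 /= normr_eq0 => /eqP.
Qed.

Lemma sq_le0 x : sq x <= 0 -> x = 0.
Proof. by move=> h; apply: sq_eq0; apply/eqP; rewrite eq_le h sq_ge0. Qed.

Lemma sq0 : sq 0 = 0. Proof. exact: re0l. Qed.

Lemma sqD x y : sq (x + y) = sq x + sq y + 2 * re x y.
Proof. by rewrite /sq reDl !reDr (reC y x); ring. Qed.

Lemma sqB x y : sq (x - y) = sq x + sq y - 2 * re x y.
Proof. by rewrite /sq reBl !reBr (reC y x); ring. Qed.

Lemma sqN x : sq (- x) = sq x.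
Proof. by rewrite -sub0r sqB sq0 re0l; ring. Qed.

Lemma sqBC x y : sq (x - y) = sq (y - x).
Proof. by rewrite -sqN opprB. Qed.

Lemma sqZ a x : (sq (a *: x))%:C = `|a| ^+ 2 * (sq x)%:C.
Proof. by rewrite !sq_norm normrZ exprMn. Qed.

Lemma sqD_le x y : sq (x + y) <= 2 * sq x + 2 * sq y.
Proof. by have := sq_ge0 (x - y); rewrite sqB sqD; lra. Qed.

Lemma sqB_le z x y : sq (x - y) <= 2 * sq (x - z) + 2 * sq (z - y).
Proof. by apply: le_trans (sqD_le _ _); rewrite addrA subrK. Qed.

Lemma young x y e : 0 < e -> 2 * re x y <= e * sq x + e^-1 * sq y.
Proof.
move=> e0; have := sq_ge0 (e%:C *: x - y).
rewrite sqB reZl /sq reZl reZr -/(sq x) -/(sq y) => h.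
rewrite -(ler_pM2l e0) mulrDr (mulrA e e^-1) divff ?gt_eqF // mul1r.
by lra.
Qed.

(** Continuity of the inner product, in the form of a criterion for
    orthogonality: y may be replaced by arbitrarily short vectors z. *)
Lemma re_small x y : (forall e, 0 < e -> exists2 z, re x z = re x y & sq z < e) ->
  re x y = 0.
Proof.
move=> h; suff abs u : (forall e, 0 < e -> exists2 z, re x z = u & sq z < e) -> u <= 0.
  apply/eqP; rewrite eq_le abs //= -oppr_le0 abs // => e /h [z <- ze].
  by exists (- z); rewrite ?sqN // -sub0r reBr re0r sub0r.
move=> {}h; apply/ler_addgt0Pl => e e0; rewrite addr0.
have s1 : 0 < sq x + 1 by rewrite ltr_wpDl ?sq_ge0.
have d0 : 0 < e / (sq x + 1) by rewrite divr_gt0.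
have [z <- ze] := h _ (mulr_gt0 d0 e0).
have := young x z d0; set d := e / _ in d0 ze *.
have de : d * sq x + d = e by rewrite /d; field; rewrite gt_eqF.
have : d^-1 * sq z <= e by rewrite ler_pdivrMl // ltW.
lra.
Qed.

Lemma norm_lt_sq x y e : 0 < e -> (`|x - y| < e%:C) = (sq (x - y) < e ^+ 2).
Proof.
move=> e0; rewrite -ltcR sq_norm rmorphXn /= ltr_pXn2r //.
  by rewrite nnegrE.
by rewrite nnegrE ler0c ltW.
Qed.

Lemma closureP (G : set (H * H)) (p : H * H) : closure G p <->
  forall e, 0 < e -> exists q, [/\ G q, sq (p.1 - q.1) < e & sq (p.2 - q.2) < e].
Proof.
split=> [cG e e0|h B /nbhs_ballP[e /= e0 eB]].
  have d0 : 0 < Num.sqrt e by rewrite sqrtr_gt0.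
  have /cG[q [Gq []]] : nbhs p (ball p (Num.sqrt e)%:C).
    by apply: nbhsx_ballx; rewrite ltcR.
  rewrite -!ball_normE /= !norm_lt_sq // !sqr_sqrtr ?ltW // => q1 q2.
  by exists q.
have eE : e = (complex.Re e)%:C by rewrite RRe_real // ger0_real // ltW.
have d0 : 0 < complex.Re e by rewrite -ltcR -eE.
have [q [Gq q1 q2]] := h _ (exprn_gt0 2 d0).
exists q; split=> //; apply: eB; rewrite eE; split.
  by rewrite -ball_normE /= norm_lt_sq.
by rewrite -ball_normE /= norm_lt_sq.
Qed.

Lemma complete (u : nat -> H) :
  (forall e, 0 < e -> exists N, forall n m, (N <= n)%N -> (N <= m)%N ->
     sq (u n - u m) < e) ->
  exists l, forall e, 0 < e -> exists N, forall n, (N <= n)%N -> sq (u n - l) < e.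
Proof.
move=> h; have /cauchy_cvg/cvg_ex[l ul] : cauchy (u @ \oo).
  apply: cauchy_exP => e e0.
  have eE : e = (complex.Re e)%:C by rewrite RRe_real // ger0_real // ltW.
  have d0 : 0 < complex.Re e by rewrite -ltcR -eE.
  have [N hN] := h _ (exprn_gt0 2 d0).
  exists (u N); exists N => // n Nn; rewrite eE -ball_normE /= norm_lt_sq //.
  exact: hN.
exists l => e e0.
have d0 : 0 < Num.sqrt e by rewrite sqrtr_gt0.
move/cvgrPdist_lt : ul => /(_ (Num.sqrt e)%:C); rewrite ltcR => /(_ d0) [N _ hN].
exists N => n /hN /=; rewrite sqBC norm_lt_sq // sqr_sqrtr // ltW //.
Qed.

Lemma denseP (D : set H) x e : dense D -> 0 < e -> exists2 y, D y & sq (x - y) < e.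
Proof.
move=> dD e0.
have d0 : 0 < Num.sqrt e by rewrite sqrtr_gt0.
have [] := dD (ball x (Num.sqrt e)%:C).
- by exists x; apply: ballxx; rewrite ltcR.
- by apply: ball_open; rewrite ltcR.
move=> y [+ Dy]; rewrite -ball_normE /= norm_lt_sq // sqr_sqrtr ?ltW // => xy.
by exists y.
Qed.

End Hilbert.

(** * Closed subspaces of the Hilbert sum *)

Section Operators.
Context {R : realType} {H : hilbertType R}.
Implicit Types (x y z : H) (a : R[i]) (r e : R) (G T : set (H * H)).

Local Notation ip := (inner H).

Lemma linear_subspaceP (V : lmodType R[i]) (S : set V) : linear_subspace S <->
  S 0 /\ forall a u v, S u -> S v -> S (a *: u + v).
Proof.
rewrite /linear_subspace; split=> [[h0 hl]|[h0 hl]].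
  split=> [|a u v Su Sv]; first exact: set_mem h0.
  by apply: set_mem; apply: hl; apply: mem_set.
split=> [|a u v /set_mem Su /set_mem Sv]; first exact: mem_set.
exact/mem_set/hl.
Qed.

Section Subspace.
Variables (G : set (H * H)) (lG : linear_subspace G).

Lemma lin0 : G (0, 0). Proof. by have [] := (linear_subspaceP _).1 lG. Qed.

Lemma linD x y u v : G (x, y) -> G (u, v) -> G (x + u, y + v).
Proof.
move=> h1 h2; have [_ /(_ 1 _ _ h1 h2)] := (linear_subspaceP _).1 lG.
by rewrite scale1r.
Qed.

Lemma linZ a x y : G (x, y) -> G (a *: x, a *: y).
Proof.
move=> h; have [_ /(_ a _ _ h lin0)] := (linear_subspaceP _).1 lG.
by rewrite addr0.
Qed.

Lemma linN x y : G (x, y) -> G (- x, - y).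
Proof. by rewrite -(scaleN1r x) -(scaleN1r y); exact: linZ. Qed.

Lemma linB x y u v : G (x, y) -> G (u, v) -> G (x - u, y - v).
Proof. by move=> h1 h2; apply: linD => //; exact: linN. Qed.

End Subspace.

Lemma linear_closure G : linear_subspace G -> linear_subspace (closure G).
Proof.
move=> lG; apply/linear_subspaceP; split; first by apply: subset_closure; exact: lin0.
move=> a [x y] [u v] /closureP h1 /closureP h2; apply/closureP => e e0 /=.
pose c := complex.Re (`|a| ^+ 2).
have ce : `|a| ^+ 2 = c%:C by rewrite /c RRe_real // ger0_real // exprn_ge0.
have c0 : 0 <= c by rewrite -ler0c -ce exprn_ge0.
have sqa (w : H) : sq (a *: w) = c * sq w.
  by apply: complexI; rewrite sqZ ce rmorphM.
have e4 : 0 < e / 4 by lra.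
have d0 : 0 < e / (4 * (c + 1)) by rewrite divr_gt0 //; lra.
have [[x1 y1] /= [G1 hx1 hy1]] := h1 _ d0.
have [[u1 v1] /= [G2 hu1 hv1]] := h2 _ e4.
exists (a *: x1 + u1, a *: y1 + v1) => /=; split.
- by apply: linD => //; exact: linZ.
- rewrite opprD addrACA -scalerBr; apply: le_lt_trans (sqD_le _ _) _.
  rewrite sqa; have : c * sq (x - x1) <= (c + 1) * (e / (4 * (c + 1))).
    by apply: ler_pM => //; [exact: sq_ge0|lra|exact: ltW].
  have -> : (c + 1) * (e / (4 * (c + 1))) = e / 4 by field; lra.
  by lra.
- rewrite opprD addrACA -scalerBr; apply: le_lt_trans (sqD_le _ _) _.
  rewrite sqa; have : c * sq (y - y1) <= (c + 1) * (e / (4 * (c + 1))).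
    by apply: ler_pM => //; [exact: sq_ge0|lra|exact: ltW].
  have -> : (c + 1) * (e / (4 * (c + 1))) = e / 4 by field; lra.
  by lra.
Qed.

Lemma closed_mem G p : closed G -> closure G p -> G p.
Proof. by move=> /closure_id {2}->. Qed.

Lemma invS_lt e : 0 < e -> exists N, forall n, (N <= n)%N -> n.+1%:R^-1 < e.
Proof.
move=> e0; exists (Num.bound e^-1) => n hn.
rewrite invf_plt ?posrE //; apply: lt_le_trans (archi_boundP _) _.
  by rewrite invr_ge0 ltW.
by rewrite ler_nat (leq_trans hn).
Qed.

Lemma sqZr r x : sq (r%:C *: x) = r ^+ 2 * sq x.
Proof. by rewrite /sq reZl reZr expr2 mulrA. Qed.

(** Orthogonal projection onto a closed subspace of the Hilbert sum H + H. The
    product carries the maximum norm, which defines the same topology but no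
    inner product, so the minimisation of the Hilbert distance is carried out
    on components. A graph being such a subspace, this one statement yields
    the biadjoint theorem, resolvents and the density of cores. *)
Lemma projection G h k : closed G -> linear_subspace G ->
  exists u v, G (u, v) /\ forall u' v', G (u', v') -> re (h - u) u' + re (k - v) v' = 0.
Proof.
move=> cG lG; pose d (p : H * H) := sq (h - p.1) + sq (k - p.2).
pose E := d @` G; pose m := inf E.
have dlb p : G p -> m <= d p.
  move=> Gp; apply: ge_inf; last by exists p.
  by exists 0 => _ [q _ <-]; rewrite addr_ge0 ?sq_ge0.
have hasE : has_inf E.
  split; first by exists (d (0, 0)); exists (0, 0) => //; exact: lin0.
  by exists 0 => _ [q _ <-]; rewrite addr_ge0 ?sq_ge0.
have /choice[p pP] : forall n : nat, exists p, G p /\ d p < m + n.+1%:R^-1.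
  move=> n; have n0 : (0 : R) < n.+1%:R^-1 by rewrite invr_gt0.
  by have [_ [q Gq <-] qm] := inf_adherent n0 hasE; exists q.
have par n l : sq ((p n).1 - (p l).1) + sq ((p n).2 - (p l).2) <=
    2 * n.+1%:R^-1 + 2 * l.+1%:R^-1.
  have [[Gn dn] [Gl dl]] := (pP n, pP l).
  pose w := (2^-1)%:C *: (p n + p l).
  have Gw : G w.
    rewrite /w; case: (p n) (p l) Gn Gl => [? ?] [? ?] Gn Gl.
    by apply: linZ => //; exact: linD.
  (* parallelogram law, in terms of the distances to x and of the midpoint *)
  have median (x a b : H) : sq (a - b) =
      2 * sq (x - a) + 2 * sq (x - b) - 4 * sq (x - (2^-1)%:C *: (a + b)).
    have -> : sq (a - b) = sq ((x - b) - (x - a)).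
      by congr sq; rewrite opprB [RHS]addrC subrKA.
    have -> : x - (2^-1)%:C *: (a + b) = (2^-1)%:C *: ((x - a) + (x - b)).
      rewrite [in RHS]addrACA -opprD [RHS]scalerDr scalerN; congr (_ - _).
      rewrite scalerDr -scalerDl -rmorphD /=.
      have -> : 2^-1 + 2^-1 = 1 :> R by lra.
      by rewrite rmorph1 scale1r.
    rewrite sqZr.
    by move: (x - a) (x - b) => p1 q1; rewrite sqB sqD (reC q1); lra.
  rewrite (median h (p n).1 (p l).1) (median k (p n).2 (p l).2).
  have := dlb _ Gw; rewrite /d in dn dl *; rewrite /w /=.
  by move: (n.+1%:R^-1) (l.+1%:R^-1) dn dl => i j dn dl; lra.
have [u hu] : exists u, forall e, 0 < e -> exists N, forall n, (N <= n)%N ->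
    sq ((p n).1 - u) < e.
  apply: complete => e e0; have e4 : 0 < e / 4 by lra.
  have [N hN] := invS_lt e4; exists N => n l hn hl.
  move: (par n l) (hN _ hn) (hN _ hl) (sq_ge0 ((p n).2 - (p l).2)).
  by move: (n.+1%:R^-1) (l.+1%:R^-1) => i j; lra.
have [v hv] : exists v, forall e, 0 < e -> exists N, forall n, (N <= n)%N ->
    sq ((p n).2 - v) < e.
  apply: complete => e e0; have e4 : 0 < e / 4 by lra.
  have [N hN] := invS_lt e4; exists N => n l hn hl.
  move: (par n l) (hN _ hn) (hN _ hl) (sq_ge0 ((p n).1 - (p l).1)).
  by move: (n.+1%:R^-1) (l.+1%:R^-1) => i j; lra.
have approx e : 0 < e -> exists q,
    [/\ G q, sq (u - q.1) < e, sq (v - q.2) < e & d q < m + e].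
  move=> e0; have [N1 h1] := hu _ e0; have [N2 h2] := hv _ e0.
  have [N3 h3] := invS_lt e0; pose n := (N1 + N2 + N3)%N.
  exists (p n); have [Gn dn] := pP n; split=> //.
  - by rewrite sqBC; apply: h1; rewrite /n -addnA leq_addr.
  - by rewrite sqBC; apply: h2; rewrite /n addnAC leq_addl.
  - by apply: lt_trans dn _; rewrite ltrD2l h3 // leq_addl.
exists u, v; split.
  apply: closed_mem => //; apply/closureP => e /approx[q [*]].
  by exists q.
move=> u' v' Gw; set rho := _ + _; set W := sq u' + sq v'.
have W0 : 0 <= W by rewrite addr_ge0 ?sq_ge0.
(* first variation of d at the minimum, in the direction (u', v') *)
have key t : 2 * t * rho <= t ^+ 2 * W.
  apply/ler_addgt0Pl => e e0.
  have T0 : 0 < t ^+ 2 * W + 1 by rewrite ltr_wpDl // mulr_ge0 // sqr_ge0.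
  pose s := e / 2 / (t ^+ 2 * W + 1).
  have s0 : 0 < s by rewrite divr_gt0 //; lra.
  have se : s * (t ^+ 2 * W) + s = e / 2 by rewrite /s; field; rewrite gt_eqF.
  have es0 : 0 < Num.min (e / 4) (s * (e / 16)).
    by rewrite lt_min; apply/andP; split; [|apply: mulr_gt0 => //]; lra.
  have [q [Gq]] := approx _ es0; rewrite !lt_min.
  move=> /andP[_ q1] /andP[_ q2] dq.
  have dq' : d q < m + e / 4 by apply: lt_le_trans dq _; rewrite lerD2l ge_min lexx.
  have Gt : G (q.1 + t%:C *: u', q.2 + t%:C *: v').
    by apply: linD => //; [case: (q) Gq|exact: linZ].
  have := dlb _ Gt; rewrite /d /= !opprD !addrA => mt.
  rewrite (sqB (h - q.1)) (sqB (k - q.2)) !sqZr !reZr in mt.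
  have y1 := young ((- t)%:C *: u') (u - q.1) s0.
  have y2 := young ((- t)%:C *: v') (v - q.2) s0.
  rewrite !sqZr !reZl in y1 y2.
  have z1 : s^-1 * sq (u - q.1) <= e / 16 by rewrite ler_pdivrMl // ltW.
  have z2 : s^-1 * sq (v - q.2) <= e / 16 by rewrite ler_pdivrMl // ltW.
  rewrite /d in dq'.
  have r1 : re (h - u) u' = re (h - q.1) u' - re u' (u - q.1).
    by rewrite (reC u') -reBl opprB addrA subrK.
  have r2 : re (k - v) v' = re (k - q.2) v' - re v' (v - q.2).
    by rewrite (reC v') -reBl opprB addrA subrK.
  rewrite /rho r1 r2; rewrite /W in se *.
  lra.
(* any t of the sign of rho and of size less than 2 rho / W gives rho = 0 *)
have := key (rho / (W + 1)).
have W1 : 0 < W + 1 by lra.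
have -> : (rho / (W + 1)) ^+ 2 * W = rho ^+ 2 / (W + 1) * (W / (W + 1)).
  by field; rewrite gt_eqF.
have -> : 2 * (rho / (W + 1)) * rho = 2 * (rho ^+ 2 / (W + 1)).
  by field; rewrite gt_eqF.
have W2 : W / (W + 1) <= 1 by rewrite ler_pdivrMr //; lra.
have : 0 <= rho ^+ 2 / (W + 1) by rewrite divr_ge0 ?sqr_ge0 // ltW.
set X := rho ^+ 2 / (W + 1) => X0 hX.
have : X * (W / (W + 1)) <= X by rewrite ler_piMr.
move=> hX2; have /eqP : X = 0 by lra.
by rewrite mulf_eq0 invr_eq0 (gt_eqF W1) orbF sqrf_eq0 => /eqP.
Qed.

End Operators.

(** * Adjoints, cores and equality of norms *)

Section Adjoint.
Context {R : realType} {H : hilbertType R}.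
Implicit Types (x y z : H) (a : R[i]) (r e : R) (G T : set (H * H)).

Local Notation ip := (inner H).

Definition functional G := forall x y z, G (x, y) -> G (x, z) -> y = z.

(** Testing against the multiples a = 1 and a = - i recovers a complex number
    from real parts. *)
Lemma ip_reP x y u v :
  (forall a, re (a *: x) u = re (a *: y) v) -> ip x u = ip y v.
Proof.
move=> h; have h1 := h 1; have h2 := h (- 'i).
rewrite !scale1r in h1; rewrite /re !ipZl in h2.
move: h1 h2; rewrite /re; case: (ip x u) (ip y v) => [p q] [s t] /=.
by move=> -> h2; congr (_ +i* _); lra.
Qed.

Lemma adjP T (p : H * H) : linear_subspace T ->
  adj T p <-> forall x y, T (x, y) -> re y p.1 = re x p.2.
Proof.
move=> lT; split=> [h x y Txy|h x y Txy]; first by rewrite /re (h _ _ Txy).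
by apply: ip_reP => a; apply: h; exact: linZ.
Qed.

Lemma adj_linear T : linear_subspace (adj T).
Proof.
apply/linear_subspaceP; split=> [x y _|a u v hu hv x y Txy] /=; first by rewrite !ip0r.
by rewrite !ipDr !ipZr (hu _ _ Txy) (hv _ _ Txy).
Qed.

Lemma adj_closed T : linear_subspace T -> closed (adj T).
Proof.
move=> lT; apply/closure_id/seteqP; split; first exact: subset_closure.
move=> [x x'] /closureP h; apply/adjP => // u v Tuv /=.
apply/eqP; rewrite -subr_eq0; apply/eqP.
suff key : forall e, 0 < e -> `|re v x - re u x'| <= e.
  apply/eqP; rewrite -normr_eq0 eq_le normr_ge0 andbT.
  by apply/ler_addgt0Pl => e e0; rewrite addr0 key.
move=> e e0; pose M := sq v + sq u + 1.
have M0 : 0 < M by have := sq_ge0 v; have := sq_ge0 u; rewrite /M; lra.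
pose d := e / M.
have d0 : 0 < d by rewrite divr_gt0.
have dM : d * sq v + d * sq u + d = e.
  by rewrite /d /M; field; rewrite gt_eqF.
have dd0 : 0 < d * (d / 2) by rewrite mulr_gt0 // divr_gt0.
have [[y y'] /= [Yy hy hy']] := h _ dd0.
have := Yy _ _ Tuv => /(congr1 (@complex.Re _)) /= yE.
have -> : re v x - re u x' = re v (x - y) - re u (x' - y').
  by rewrite !reBr /re yE; lra.
have y1 : d^-1 * sq (x - y) <= d / 2 by rewrite ler_pdivrMl // ltW.
have y2 : d^-1 * sq (x' - y') <= d / 2 by rewrite ler_pdivrMl // ltW.
have := young v (x - y) d0; have := young u (x' - y') d0.
have := young (- v) (x - y) d0; have := young (- u) (x' - y') d0.
rewrite !sqN !reNl => *.
by rewrite ler_norml; apply/andP; split; lra.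
Qed.

Lemma adj_functional T : densely_defined T -> functional (adj T).
Proof.
move=> dT x y z hy hz; apply/eqP; rewrite -subr_eq0; apply/eqP/sq_eq0.
apply: re_small => e e0; have [w [[w1 w2] Tw /= wE] hw] := denseP (y - z) dT e0.
exists (y - z - w) => //; rewrite reBr.
have -> : re (y - z) w = 0.
  by rewrite -wE reC reBr /re -(hy _ _ Tw) -(hz _ _ Tw) subrr.
by rewrite subr0.
Qed.

Lemma adjI T p : T p -> adj (adj T) p.
Proof. by case: p => u v Tuv x y /(_ _ _ Tuv) /= h; rewrite ipC -h -ipC. Qed.

(** The way all density arguments are run: to reach p of K from the closed
    subspace G of K, show that nothing in K is orthogonal to G. *)
Lemma mem_closed G K p : closed G -> linear_subspace G -> linear_subspace K ->
  G `<=` K -> K p ->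
  (forall x y, K (x, y) -> (forall u v, G (u, v) -> re x u + re y v = 0) ->
     x = 0 /\ y = 0) -> G p.
Proof.
move=> cG lG lK GK; case: p => x y Kp h.
have [u [v [Guv uv]]] := projection x y cG lG.
have [|/eqP xu /eqP yv] := h (x - u) (y - v) _ uv.
  by apply: linB => //; exact: GK.
by move: xu yv; rewrite !subr_eq0 => /eqP-> /eqP->.
Qed.

(** A pair (x, y) of the biadjoint that is orthogonal to T makes (y, - x) an
    element of the adjoint; pairing the two gives |x|^2 + |y|^2 = 0. *)
Lemma adjK T : closed T -> linear_subspace T -> adj (adj T) = T.
Proof.
move=> cT lT; apply/seteqP; split; last exact: adjI.
move=> p Tp; apply: mem_closed (Tp) _ => //; [exact: adj_linear|exact: adjI|].
move=> x y /adjP-/(_ (@adj_linear T)) hxy o.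
have /hxy /= : adj T (y, - x).
  apply/adjP => // u v /o /=; rewrite reNr (reC x) (reC y); lra.
rewrite reNl -!/(sq _) => h.
have [h1 h2] := (sq_ge0 x, sq_ge0 y).
by split; apply: sq_le0; lra.
Qed.

(** Projecting (x, 0) onto the graph of T solves u + T'(T u) = x, where T' is
    the adjoint. *)
Lemma resolvent T x : closed T -> linear_subspace T ->
  exists u v, T (u, v) /\ adj T (v, x - u).
Proof.
move=> cT lT; have [u [v [Tuv h]]] := projection x 0 cT lT.
exists u, v; split=> //; apply/adjP => // u' v' /h /=.
by rewrite sub0r reNl (reC v') (reC u'); lra.
Qed.

Lemma resolvent_uniq T u v w : linear_subspace T ->
  T (u, v) -> adj T (v, w) -> u + w = 0 -> u = 0 /\ v = 0.
Proof.
move=> lT Tuv /adjP-/(_ lT)/(_ _ _ Tuv) /= + /eqP; rewrite addr_eq0 => + /eqP uw.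
rewrite uw reNl -/(sq v) -/(sq w) => h.
have h1 := sq_ge0 v; have h2 := sq_ge0 w.
have v0 : v = 0 by apply: sq_le0; lra.
have w0 : w = 0 by apply: sq_le0; lra.
by rewrite w0 oppr0.
Qed.

Lemma restr_dom_linear T : linear_subspace T ->
  linear_subspace (restr_op T (dom (comp_op (adj T) T))).
Proof.
move=> lT; have la := @adj_linear T; apply/linear_subspaceP; split.
  split; first exact: lin0.
  by exists (0, 0) => //; exists 0; exact: lin0.
move=> a [u v] [u' v'] [/= T1 [[u1 w] [y /= Ty Ay] /= E1]].
move=> [/= T2 [[u2 w'] [y' /= Ty' Ay'] /= E2]].
split; first by apply: linD => //; exact: linZ.
exists (a *: u + u', a *: w + w') => //; exists (a *: y + y') => /=.
  by rewrite -E1 -E2; apply: linD => //; exact: linZ.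
by apply: (linD la) => //; exact: (linZ la).
Qed.

(** An element (x, T x) orthogonal to the graph of the restriction is
    orthogonal to (u, T u) for the solution u of u + T'(T u) = x, and this
    inner product is |x|^2. *)
Lemma dom_core T p : closed T -> linear_subspace T -> functional T -> T p ->
  closure (restr_op T (dom (comp_op (adj T) T))) p.
Proof.
move=> cT lT fT Tp.
have lD := restr_dom_linear lT.
apply: mem_closed (Tp) _ => //; [exact: closed_closure|exact: linear_closure| |].
  by move=> q cq; apply: closed_mem => //; apply: closureS cq => ? [].
move=> x y Txy o; have [u [v [Tuv Av]]] := resolvent x cT lT.
have : re x u + re y v = 0.
  apply: o; apply: subset_closure; split=> //.
  by exists (u, x - u) => //; exists v.
have /adjP-/(_ lT)/(_ _ _ Txy) /= -> := Av.
rewrite -reDr addrC subrK => /sq_eq0 x0; rewrite x0 in Txy *.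
by split=> //; apply: fT Txy (lin0 lT).
Qed.

Lemma sq_lim x y : (forall e, 0 < e -> exists u v,
  [/\ sq u = sq v, sq (x - u) < e & sq (y - v) < e]) -> sq x = sq y.
Proof.
move=> h; apply/eqP; rewrite -subr_eq0 -normr_eq0 eq_le normr_ge0 andbT.
apply/ler_addgt0Pl => e e0; rewrite addr0.
pose M := sq x + sq y + 3; have M0 : 0 < M.
  by have := sq_ge0 x; have := sq_ge0 y; rewrite /M; lra.
pose d := Num.min 1 (e / M).
have d0 : 0 < d by rewrite lt_min ltr01 divr_gt0.
have d1 : d <= 1 by rewrite ge_min lexx.
have de : d * sq x + d * sq y + d * 3 <= e.
  rewrite -!mulrDr -/M -ler_pdivlMr //; by rewrite ge_min lexx orbT.
have [u [v [uv xu yv]]] := h _ (mulr_gt0 d0 d0).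
have E (s t : H) : sq t = sq s - 2 * re (s - t) s + sq (s - t).
  by rewrite sqB reBl /sq (reC t s); lra.
have := E x u; have := E y v.
have dd : d * d <= d by rewrite ler_piMr // ltW.
have Y (s t : H) : sq (s - t) < d * d ->
    2 * re (s - t) s <= d * sq s + d /\ - (2 * re (s - t) s) <= d * sq s + d.
  move=> st; have st' : d^-1 * sq (s - t) <= d by rewrite ler_pdivrMl // ltW.
  have := young s (s - t) d0; have := young (- s) (s - t) d0.
  by rewrite sqN reNl (reC s); split; lra.
have [x1 x2] := Y _ _ xu; have [y1 y2] := Y _ _ yv.
have s1 := sq_ge0 (x - u); have s2 := sq_ge0 (y - v).
move=> e1 e2; rewrite ler_norml; apply/andP; split; lra.
Qed.

(** If Y x has the same norm as V x for every x in the domain of V, then a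
    sequence that converges for the graph norm of V also converges for that
    of Y. *)
Lemma closure_transfer (V Y : set (H * H)) (p : H * H) :
  linear_subspace V -> linear_subspace Y -> closed Y ->
  (forall x y, V (x, y) -> exists z, Y (x, z) /\ sq z = sq y) -> functional Y ->
  closure V p -> exists z, Y (p.1, z) /\ sq z = sq p.2.
Proof.
move=> lV lY cY h fY; case: p => x x' /closureP cp.
have /choice[w wP] : forall n : nat, exists w : H * H * H, [/\ V w.1, Y (w.1.1, w.2),
    sq w.2 = sq w.1.2, sq (x - w.1.1) < n.+1%:R^-1 & sq (x' - w.1.2) < n.+1%:R^-1].
  move=> n; have n0 : (0 : R) < n.+1%:R^-1 by rewrite invr_gt0.
  have [[u u'] [Vu h1 h2]] := cp _ n0; have [z [Yz zE]] := h _ _ Vu.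
  by exists (u, u', z).
have [l hl] : exists l, forall e, 0 < e ->
    exists N, forall n, (N <= n)%N -> sq ((w n).2 - l) < e.
  apply: complete => e e0; have e4 : 0 < e / 4 by lra.
  have [N hN] := invS_lt e4; exists N => n m hn hm.
  have [V1 Y1 _ _ q1] := wP n; have [V2 Y2 _ _ q2] := wP m.
  have VV : V ((w n).1.1 - (w m).1.1, (w n).1.2 - (w m).1.2).
    by move: V1 V2; case: (w n) => [[? ?] ?]; case: (w m) => [[? ?] ?]; apply: linB.
  have [z [Yz zE]] := h _ _ VV.
  rewrite -(fY _ _ _ Yz (linB lY Y1 Y2)) zE.
  apply: le_lt_trans (sqB_le x' _ _) _; rewrite (sqBC _ x').
  move: (hN _ hn) (hN _ hm) q1 q2.
  by move: (n.+1%:R^-1) (m.+1%:R^-1) => i j; lra.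
have ap e : 0 < e -> exists n, [/\ sq (x - (w n).1.1) < e,
    sq (x' - (w n).1.2) < e & sq (l - (w n).2) < e].
  move=> e0; have [N1 h1] := invS_lt e0; have [N2 h2] := hl _ e0.
  exists (N1 + N2)%N; have [_ _ _ q1 q2] := wP (N1 + N2)%N.
  have hN := h1 _ (leq_addr N2 N1).
  by split; [exact: lt_trans q1 hN|exact: lt_trans q2 hN|rewrite sqBC h2 ?leq_addl].
exists l; split.
  apply: closed_mem => //; apply/closureP => e /ap [n [h1 h2 h3]].
  by have [_ Yn _ _ _] := wP n; exists ((w n).1.1, (w n).2).
apply: sq_lim => e /ap [n [h1 h2 h3]]; have [_ _ sE _ _] := wP n.
by exists (w n).2, (w n).1.2.
Qed.

(** The two norms agree on the domain of T'T = TT', directly from the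
    definition of the adjoint, and this domain is a core. *)
Lemma normal_sq T x y : linear_subspace T -> closed T -> functional T ->
  functional (adj T) -> comp_op T (adj T) = comp_op (adj T) T -> T (x, y) ->
  exists z, adj T (x, z) /\ sq z = sq y.
Proof.
move=> lT cT fT fa hn Txy.
have := dom_core cT lT fT Txy; set V := restr_op _ _ => cV.
have lV := restr_dom_linear lT.
apply: closure_transfer cV => //; [exact: adj_linear|exact: adj_closed|].
move=> u v [/= Tuv [[u1 w] /= C /= uE]]; rewrite {}uE in C.
have := C; rewrite -hn => -[/= z Az Tz]; exists z; split=> //.
case: C => /= v' Tv' Av'; have -> : v = v' := fT _ _ _ Tuv Tv'.
rewrite /sq /re (Av' _ _ Tv') /=.
by rewrite -(Az _ _ Tz) -/(re w u) reC.
Qed.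

End Adjoint.

(** * Normal operators and their resolvents *)

Section Normal.
Context {R : realType} {H : hilbertType R}.
Implicit Types (x y z u v w : H) (a : R[i]) (r e c : R) (G T : set (H * H)).
Implicit Types (J L K : H -> H).

Local Notation ip := (inner H).

(** Normality with the density of the domain replaced by its consequence that
    the adjoint is single-valued; this form passes to the adjoint at once. *)
Definition prenormal T : Prop := [/\ linear_subspace T, closed T, functional T,
  functional (adj T) & comp_op T (adj T) = comp_op (adj T) T].

Lemma normal_prenormal T : normal_op T -> prenormal T.
Proof. by case=> -[lT fT] dT cT nT; split=> //; exact: adj_functional. Qed.

Lemma prenormal_adj T : prenormal T -> prenormal (adj T).
Proof.
case=> lT cT fT fa hn; split; rewrite ?adjK //; first exact: adj_linear.
exact: adj_closed.
Qed.

Lemma prenormal_sq T x y : prenormal T -> T (x, y) ->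
  exists z, adj T (x, z) /\ sq z = sq y.
Proof. by case=> *; exact: normal_sq. Qed.

Lemma prenormal_sqV T x y : prenormal T -> adj T (x, y) ->
  exists z, T (x, z) /\ sq z = sq y.
Proof.
move=> hT; move: (hT) => [lT cT _ _ _] /(prenormal_sq (prenormal_adj hT)).
by rewrite adjK.
Qed.

Lemma polarization T x x' x'' y y' y'' : linear_subspace T -> functional (adj T) ->
  (forall x y, T (x, y) -> exists z, adj T (x, z) /\ sq z = sq y) ->
  T (x, x') -> T (y, y') -> adj T (x, x'') -> adj T (y, y'') -> re x' y' = re x'' y''.
Proof.
move=> lT fa hsq Tx Ty Ax Ay.
have sqE s s' s'' : T (s, s') -> adj T (s, s'') -> sq s'' = sq s'.
  by move=> /hsq[w [Aw <-]] As; rewrite (fa _ _ _ As Aw).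
have := sqE _ _ _ (linD lT Tx Ty) (linD (@adj_linear _ _ T) Ax Ay).
by rewrite !sqD (sqE _ _ _ Tx Ax) (sqE _ _ _ Ty Ay); lra.
Qed.

(** Converse of the equality of norms: by polarization T and T' have the same
    inner products on their common domain, so that testing T'(T x) against a
    vector amounts to testing T(T' x) against it. *)
Lemma normal_of_isometric T : is_operator T -> densely_defined T -> closed T ->
  (forall x y, T (x, y) -> exists z, adj T (x, z) /\ sq z = sq y) ->
  (forall x y, adj T (x, y) -> exists z, T (x, z)) -> normal_op T.
Proof.
move=> [lT fT] dT cT hsq hdom; split=> //.
have fa := adj_functional dT; have la := @adj_linear _ _ T.
have pol := polarization lT fa hsq.
apply/seteqP; split=> -[x z] [y /= h1 h2].
  have [x' Tx] := hdom _ _ h1; exists x' => //=.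
  apply/adjP => // u u' Tu /=; have [u'' [Au _]] := hsq _ _ Tu.
  by rewrite (pol _ _ _ _ _ _ Tu Tx Au h1) reC /re -(Au _ _ h2) /= -/(re z u) reC.
have [x'' [Ax _]] := hsq _ _ h1; exists x'' => //=.
rewrite -(adjK cT lT); apply/adjP => // u u'' Au /=; have [u' Tu] := hdom _ _ Au.
by rewrite -(pol _ _ _ _ _ _ Tu h1 Au Ax) /re -(h2 _ _ Tu).
Qed.

Definition linear_map L := forall a x y, L (a *: x + y) = a *: L x + L y.
Definition bounded_map c L := forall x, sq (L x) <= c * sq x.
Definition commutes L T := forall x y, T (x, y) -> T (L x, L y).
(** J is the everywhere defined inverse of 1 + T'T. *)
Definition resolves T J := forall x, exists v, T (J x, v) /\ adj T (v, x - J x).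

Lemma linear_map0 L : linear_map L -> L 0 = 0.
Proof. by move=> /(_ (-1) 0 0); rewrite scaler0 addr0 scaleN1r addNr. Qed.
Lemma linear_mapD L x y : linear_map L -> L (x + y) = L x + L y.
Proof. by move=> /(_ 1 x y); rewrite !scale1r. Qed.
Lemma linear_mapZ L a x : linear_map L -> L (a *: x) = a *: L x.
Proof. by move=> hL; have := hL a x 0; rewrite (linear_map0 hL) !addr0. Qed.
Lemma linear_mapN L x : linear_map L -> L (- x) = - L x.
Proof. by rewrite -scaleN1r -(scaleN1r (L x)); exact: linear_mapZ. Qed.
Lemma linear_mapB L x y : linear_map L -> L (x - y) = L x - L y.
Proof. by move=> hL; rewrite linear_mapD // linear_mapN. Qed.

Lemma exists_resolves T : closed T -> linear_subspace T -> exists J, resolves T J.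
Proof.
move=> cT lT.
have /choice[J hJ] : forall x, exists u, exists v, T (u, v) /\ adj T (v, x - u).
  by move=> x; exact: resolvent.
by exists J.
Qed.

Lemma iter_self L n x y : (forall x y, ip (L x) y = ip x (L y)) ->
  ip (iter n L x) y = ip x (iter n L y).
Proof. by move=> sL; elim: n x y => //= n IH x y; rewrite sL IH -iterSr. Qed.

Section Resolvent.
Variables (T : set (H * H)) (hT : prenormal T) (J : H -> H) (hJ : resolves T J).

Let lT : linear_subspace T. Proof. by case: hT. Qed.
Let cT : closed T. Proof. by case: hT. Qed.
Let fT : functional T. Proof. by case: hT. Qed.
Let fa : functional (adj T). Proof. by case: hT. Qed.
Let la : linear_subspace (adj T). Proof. exact: adj_linear. Qed.
Let nT : comp_op T (adj T) = comp_op (adj T) T. Proof. by case: hT. Qed.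

Lemma resolves_adj : resolves (adj T) J.
Proof.
move=> x; rewrite adjK //; have [v [Tv Av]] := hJ x.
have : comp_op (adj T) T (J x, x - J x) by exists v.
by rewrite -nT => -[w /= h1 h2]; exists w.
Qed.

Lemma resolves_uniq u v w : T (u, v) -> adj T (v, w) -> J (u + w) = u.
Proof.
move=> Tuv Avw; have [v' [Tv' Av']] := hJ (u + w).
have [] := resolvent_uniq lT (linB lT Tv' Tuv) (linB la Av' Avw).
  by rewrite addrACA (addrC (J _)) subrK -opprD subrr.
by move/eqP; rewrite subr_eq0 => /eqP.
Qed.

Lemma resolves_linear : linear_map J.
Proof.
move=> a x y; have [v [Tv Av]] := hJ x; have [w [Tw Aw]] := hJ y.
rewrite -[RHS](resolves_uniq (linD lT (linZ lT a Tv) Tw) (linD la (linZ la a Av) Aw)).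
by rewrite addrACA -scalerDr ![J _ + _]addrC !subrK.
Qed.

Lemma resolves_self x y : ip (J x) y = ip x (J y).
Proof.
have [v [Tv Av]] := hJ x; have [w [Tw Aw]] := hJ y.
have := Aw _ _ Tv; have := Av _ _ Tw; rewrite /= !ipBr => h1 h2.
have -> : ip (J x) y = ip v w + ip (J x) (J y) by rewrite h2 subrK.
rewrite [RHS]ipC; have -> : ip (J y) x = ip w v + ip (J y) (J x) by rewrite h1 subrK.
by rewrite rmorphD /= -!ipC.
Qed.

Lemma resolves_form x v : T (J x, v) -> re (J x) x = sq (J x) + sq v.
Proof.
move=> Tv; have [w [Tw Aw]] := hJ x; rewrite (fT Tv Tw).
have /adjP -/(_ lT) /(_ _ _ Tw) /= := Aw.
by rewrite reBr -/(sq w) -/(sq (J x)) => ->; lra.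
Qed.

Lemma resolves_ge0 x : 0 <= re (J x) x.
Proof.
have [v [Tv _]] := hJ x; rewrite (resolves_form Tv).
by have := sq_ge0 (J x); have := sq_ge0 v; lra.
Qed.

Lemma resolves_contraction x : sq (J x) <= sq x.
Proof.
have [v [Tv _]] := hJ x; have := resolves_form Tv.
have := sq_ge0 v; have := young (J x) x ltr01; rewrite invr1; lra.
Qed.

Lemma resolves_inj x : J x = 0 -> x = 0.
Proof.
move=> Jx; have [v [Tv Av]] := hJ x; rewrite Jx subr0 in Tv Av.
by rewrite (fT Tv (lin0 lT)) in Av; rewrite (fa Av (lin0 la)).
Qed.

Lemma resolves_inj2 x y : J x = J y -> x = y.
Proof.
move=> Jxy; apply/eqP; rewrite -subr_eq0; apply/eqP/resolves_inj.
by rewrite (linear_mapB _ _ resolves_linear) Jxy subrr.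
Qed.

(** Apply T to J x + T'T (J x) = x and exchange T with T'T = TT'. *)
Lemma resolves_commutes : commutes J T.
Proof.
move=> x x' Tx; have [v [Tv Av]] := hJ x.
have : comp_op T (adj T) (v, x' - v).
  by exists (x - J x) => //=; exact: linB.
rewrite nT => -[w /= Tw Aw]; have := resolves_uniq Tw Aw.
by rewrite addrC subrK => ->.
Qed.

(** J u and J v lie in the domain of T'T = TT', so that T may be moved across
    1 + T'T = J^-1. *)
Lemma resolves_cancel u v : T (J u, J v) -> T (u, v).
Proof.
move=> TJ; have [v0 [Tv0 Av0]] := hJ u; rewrite (fT Tv0 TJ) in Av0.
have [q [Aq]] := resolves_adj v; rewrite (fa Aq Av0) adjK // => Tq.
by have := linD lT TJ Tq; rewrite ![J _ + _]addrC !subrK.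
Qed.

(** The conjugate J^-1 L J is again bounded by the constant of L. Indeed, with
    u = J x,
      |(1 + T'T) L u|^2 = |L u|^2 + 2 |T L u|^2 + |T'T L u|^2,
    where normality turns the last term into |T T L u|^2, and L can be pulled
    out of every term because it commutes with T. Since J^-1 L J commutes with
    T as well, the step can be repeated. *)
Lemma conjugate_resolvent c L : 0 <= c -> linear_map L -> bounded_map c L ->
  commutes L T ->
  exists L', [/\ linear_map L', bounded_map c L', commutes L' T &
    forall x, L (J x) = J (L' x)].
Proof.
move=> c0 lL bL cL.
have /choice[L' hL'] : forall x, exists y, L (J x) = J y /\ sq y <= c * sq x.
  move=> x; have [v [Tv Av]] := hJ x.
  have [s [Ts sE]] := prenormal_sqV hT Av.
  have TL := cL _ _ Tv; have TL2 := cL _ _ Ts.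
  have [w [Aw wE]] := prenormal_sq hT TL2.
  exists (L (J x) + w); split; first by rewrite (resolves_uniq TL Aw).
  have h1 : re (L (J x)) w = sq (L v).
    by have /adjP-/(_ lT)/(_ _ _ TL) /= := Aw.
  have h2 : re (J x) (x - J x) = sq v.
    by have /adjP-/(_ lT)/(_ _ _ Tv) /= := Av.
  have h3 : sq x = sq (J x) + sq s + 2 * sq v.
    by rewrite -{1}(subrK (J x) x) addrC sqD h2 sE.
  rewrite sqD h1 wE h3; have := bL (J x); have := bL v; have := bL s; lra.
exists L'; split.
- move=> a x y; apply: resolves_inj2; rewrite -(hL' _).1 !resolves_linear lL.
  by rewrite -!(hL' _).1.
- by move=> x; have [] := hL' x.
- move=> x y Txy; apply: resolves_cancel; rewrite -!(hL' _).1.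
  exact/cL/resolves_commutes.
- by move=> x; have [] := hL' x.
Qed.

Lemma conjugate_resolvent_iter c L n : 0 <= c -> linear_map L -> bounded_map c L ->
  commutes L T -> exists L', [/\ linear_map L', bounded_map c L', commutes L' T &
    forall x, L (iter n J x) = iter n J (L' x)].
Proof.
move=> c0 lL bL cL; elim: n => [|n [L1 [l1 b1 c1 h1]]]; first by exists L.
have [L2 [l2 b2 c2 h2]] := conjugate_resolvent c0 l1 b1 c1.
by exists L2; split=> // x; rewrite iterSr h1 h2 iterSr.
Qed.

(** The Cauchy-Schwarz inequality for the form of K gives
    K(g, g)^2 = K(g', y)^2 <= K(g', g') K(y, y); expanding the form at
    g' - c y reaches the conclusion without it. *)
Lemma form_bound K c g g' y : linear_map K -> (forall x y, ip (K x) y = ip x (K y)) ->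
  (forall x, 0 <= re (K x) x) -> 0 < c -> re (K g') y = re (K g) g ->
  re (K g') g' <= c * re (K g) g -> re (K g) g <= c * re (K y) y.
Proof.
move=> lK sK pK c0 h1 h2; have := pK (g' - c%:C *: y).
rewrite linear_mapB // linear_mapZ // !reBl !reBr !reZl !reZr.
have -> : re (K y) g' = re (K g') y by rewrite /re sK -!/(re _ _) reC.
rewrite h1 => h3.
rewrite -(ler_pM2l c0); lra.
Qed.

(** Dual form of the uniform bound on the conjugates J^-n L J^n: the adjoint of
    L is bounded for each of the forms of J^j. For even j the form is the square
    norm of J^(j/2) x; for odd j one factor J is left over, and the form of J at
    x is the square of the graph norm of T at J x, for which L is bounded
    too. *)
Lemma resolvent_power_bound c L Ls j x : 0 < c -> linear_map L ->
  bounded_map c L -> commutes L T ->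
  (forall x y, ip (L x) y = ip x (Ls y)) ->
  re (iter j J (Ls x)) (Ls x) <= c * re (iter j J x) x.
Proof.
move=> c0 lL bL cL LsE.
pose n := j./2; set g := iter n J (Ls x); set y := iter n J x.
have itJ u v : ip (iter n J u) v = ip u (iter n J v) := iter_self n u v resolves_self.
have [Ln [ln bn cn hn]] := conjugate_resolvent_iter n (ltW c0) lL bL cL.
have E z : re (Ln z) y = re z g.
  by rewrite /re /y -itJ -hn LsE itJ.
have [jo|je] := boolP (odd j).
  have jE : j = (n + n.+1)%N by rewrite -[LHS]odd_double_half jo -addnn addnS.
  have F z : re (iter j J z) z = re (J (iter n J z)) (iter n J z).
    by rewrite jE iterD /re itJ iterS.
  rewrite !F; have [v [Tv Av]] := hJ g.
  have [L' [_ _ _ hL']] := conjugate_resolvent (ltW c0) ln bn cn.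
  apply: (@form_bound J c g (L' g) y) => //.
  - exact: resolves_linear.
  - exact: resolves_self.
  - exact: resolves_ge0.
  - by rewrite -hL' E.
  - have := cn _ _ Tv; rewrite hL' => Tv'.
    rewrite (resolves_form Tv) (resolves_form Tv') -hL'.
    by have := bn (J g); have := bn v; lra.
have jE : j = (n + n)%N by rewrite -[LHS]odd_double_half (negbTE je) -addnn.
have F z : re (iter j J z) z = re (iter n J z) (iter n J z).
  by rewrite jE iterD /re itJ.
rewrite !F; apply: (@form_bound id c g (Ln g) y) => //.
- exact: sq_ge0.
- exact: bn.
Qed.

End Resolvent.
End Normal.

(** * Cauchy's estimate for polynomials *)

Section CauchyEstimate.
Context {R : realType}.
Implicit Types (z : R[i]) (r B : R).

Lemma prim_root_exists N : (0 < N)%N -> exists w : R[i], N.-primitive_root w.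
Proof.
move=> N0; have [s Ds] := closed_field_poly_normal ('X^N - 1 : {poly R[i]}).
rewrite (monicP _) ?monicXnsubC // scale1r in Ds.
have rN : all N.-unity_root s by apply/allP => w; rewrite -root_prod_XsubC -Ds.
have sz : (N < (size s).+1)%N by rewrite -(size_prod_XsubC s id) -Ds size_XnsubC.
have [|w] := hasP (has_prim_root N0 rN _ sz); last by exists w.
by rewrite -separable_prod_XsubC -Ds separable_Xn_sub_1 // pnatr_eq0 -lt0n.
Qed.

(** Cauchy's estimate for the linear coefficient: averaging z^-1 p(z) over the
    N-th roots of unity times r isolates this coefficient once N exceeds the
    degree. *)
Lemma coef1_bound (p : {poly R[i]}) r B : 0 < r ->
  (forall z, `|z| = r%:C -> `|p.[z]| <= B%:C) -> `|p`_1| * r%:C <= B%:C.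
Proof.
move=> r0 hB; pose N := (size p).+2.
have [w wN] := @prim_root_exists N isT.
have w1 : `|w| = 1.
  have := prim_expr_order wN => /(congr1 Num.norm); rewrite normrX normr1 => /eqP.
  by rewrite pexpr_eq1 // => /eqP.
(* w^(k (N - 1)) is w^-k *)
have S : \sum_(k < N) p.[r%:C * w ^+ k] * w ^+ (k * N.-1) = N%:R * (p`_1 * r%:C).
  have pE z : p.[z] = \sum_(j < N) p`_j * z ^+ j.
    by apply: horner_coef_wide; rewrite /N -addn2 leq_addr.
  under eq_bigr => k _ do rewrite pE mulr_suml.
  rewrite exchange_big /=.
  have E (j : 'I_N) : \sum_(k < N) p`_j * (r%:C * w ^+ k) ^+ j * w ^+ (k * N.-1) =
      p`_j * r%:C ^+ j * \sum_(k < N) (w ^+ (j + N.-1)) ^+ k.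
    rewrite mulr_sumr; apply: eq_bigr => k _.
    rewrite exprMn -!exprM -!mulrA -exprD; do 2!congr (_ * _).
    by congr (_ ^+ _); rewrite mulnDl (mulnC k j) (mulnC k).
  under eq_bigr => j _ do rewrite E.
  rewrite (bigD1 (Ordinal (isT : (1 < N)%N))) //= add1n.
  rewrite [X in _ + X]big1 ?addr0 => [|j j1].
    rewrite [w ^+ _](prim_expr_order wN).
    under eq_bigr => k _ do rewrite expr1n.
    by rewrite sumr_const card_ord expr1 mulrC.
  apply/eqP; rewrite mulf_eq0; apply/orP; right.
  set t := w ^+ _; have t1 : t != 1.
    rewrite /t -(prim_order_dvd wN); apply: contra j1 => /dvdnP[q qE].
    rewrite -val_eqE /=; move: qE (ltn_ord j); rewrite /= => qE jN.
    by apply/eqP; move: q qE jN => [|[|q]]; rewrite /N /=; nia.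
  have := subrX1 t N; rewrite /t -exprM mulnC exprM (prim_expr_order wN) expr1n subrr.
  by move/esym/eqP; rewrite mulf_eq0 subr_eq0 (negbTE t1).
have : `|N%:R * (p`_1 * r%:C)| <= N%:R * B%:C.
  rewrite -S; apply: le_trans (ler_norm_sum _ _ _) _.
  rewrite -[N in N%:R * _]card_ord mulr_natl -sumr_const; apply: ler_sum => k _.
  rewrite normrM normrX w1 expr1n mulr1; apply: hB.
  by rewrite normrM normrX w1 expr1n mulr1 ger0_norm // ler0c ltW.
rewrite !normrM normr_nat ler_pM2l ?ltr0n // [`|r%:C|]ger0_norm //.
by rewrite ler0c ltW.
Qed.

End CauchyEstimate.

(** * Commutation with a resolvent *)

Section Commutant.
Context {R : realType} {H : hilbertType R}.
Implicit Types (x y z u v w : H) (a b : R[i]) (r e c : R).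
Implicit Types (J L K : H -> H).

Local Notation ip := (inner H).

(** Crude, but independent of the size of the inner product itself: it is only
    used to see that a family of polynomials is uniformly bounded. *)
Lemma norm_ip_le x y : `|ip x y| <= (sq x + sq y)%:C.
Proof.
rewrite (complexE (ip x y)); apply: le_trans (ler_normD _ _) _.
have n2 r : `|r%:C| = `|r|%:C :> R[i] by rewrite normc_def /= expr0n addr0 sqrtr_sqr.
rewrite normrM !n2 normc_def /= expr0n expr1n add0r sqrtr1 mul1r -rmorphD lecR im_re.
rewrite -/(re x y).
have sqi : sq ('i *: y) = sq y.
  by apply: complexI; rewrite sqZ normc_def /= expr0n expr1n add0r sqrtr1 expr1n mul1r.
have B u v : `|re u v| <= (sq u + sq v) / 2.
  have := young u v ltr01; have := young (- u) v ltr01.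
  rewrite reNl sqN invr1 => *; rewrite ler_norml; apply/andP; split; lra.
by have := B x y; have := B x ('i *: y); rewrite sqi; lra.
Qed.

Variable (J : H -> H).
Hypothesis (lJ : linear_map J) (sJ : forall x y, ip (J x) y = ip x (J y)).
Hypothesis (bJ : forall x, sq (J x) <= sq x).

Definition pencil a x := x + a *: J x.

Lemma pencil_linear a : linear_map (pencil a).
Proof.
move=> b x y; rewrite /pencil lJ !scalerDr addrACA !scalerA.
by rewrite (mulrC a b) -!scalerA.
Qed.

Lemma pencil_adj a x y : ip (pencil a x) y = ip x (pencil a^* y).
Proof. by rewrite /pencil ipDl ipDr ipZl ipZr sJ conjCK. Qed.

Lemma pencil_iter_adj a n x y :
  ip (iter n (pencil a) x) y = ip x (iter n (pencil a^*) y).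
Proof. by elim: n x y => //= n IH x y; rewrite pencil_adj IH -iterSr. Qed.

Lemma iter_linear L n : linear_map L -> linear_map (iter n L).
Proof. by move=> lL; elim: n => [|n IH] a x y //=; rewrite IH lL. Qed.

Lemma pencil_comm a b x : pencil a (pencil b x) = pencil b (pencil a x).
Proof.
rewrite /pencil !(linear_mapD _ _ lJ) !(linear_mapZ _ _ lJ) !scalerDr !scalerA mulrC.
by rewrite -!addrA; congr (_ + _); rewrite addrCA.
Qed.

Lemma pencil_iter_comm a b n x :
  iter n (pencil a) (iter n (pencil b) x) = iter n (fun u => pencil a (pencil b u)) x.
Proof.
elim: n x => //= n IH x; rewrite -IH; congr (pencil a _).
have sw m y : iter m (pencil a) (pencil b y) = pencil b (iter m (pencil a) y).
  by elim: m y => //= m IHm y; rewrite IHm pencil_comm.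
by rewrite sw.
Qed.

Lemma pencilN a x : pencil a (pencil (- a) x) = x - (a ^+ 2) *: J (J x).
Proof.
rewrite /pencil (linear_mapD _ _ lJ) (linear_mapZ _ _ lJ) scalerDr scalerA mulrN -expr2.
by rewrite !scaleNr addrA addrNK.
Qed.

Lemma sq_pencilN a r x : 0 < r -> `|a| = r%:C ->
  sq (pencil a (pencil (- a) x)) <= (1 + r ^+ 2) ^+ 2 * sq x.
Proof.
move=> r0 ar; rewrite pencilN.
have r2 : 0 < r ^+ 2 by rewrite exprn_gt0.
have h1 : sq (J (J x)) <= sq x by apply: le_trans (bJ _) (bJ _).
have E : sq (a ^+ 2 *: J (J x)) = (r ^+ 2) ^+ 2 * sq (J (J x)).
  by apply: complexI; rewrite sqZ normrX ar -!rmorphXn -rmorphM.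
have := young (- x) (a ^+ 2 *: J (J x)) r2.
rewrite sqB sqN reNl E mulrA expr2 mulrA mulVf ?gt_eqF // mul1r.
have := ler_wpM2l (ltW r2) h1.
have := ler_wpM2l (ltW (mulr_gt0 r2 r2)) h1.
move: (r ^+ 2) (re _ _) => s t *.
by rewrite expr2; lra.
Qed.

(** (1 + aJ)^n and (1 - aJ)^n are inverse to each other up to the factor
    (1 - a^2 J^2)^n, which is harmless as soon as n |a|^2 stays bounded. *)
Lemma sq_pencilN_iter a r n x : 0 < r -> `|a| = r%:C ->
  sq (iter n (pencil a) (iter n (pencil (- a)) x)) <= ((1 + r ^+ 2) ^+ 2) ^+ n * sq x.
Proof.
move=> r0 ar; rewrite pencil_iter_comm; elim: n => [|n IH] /=.
  by rewrite expr0 mul1r.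
apply: le_trans (sq_pencilN _ r0 ar) _; rewrite [_ ^+ n.+1]exprS -mulrA.
apply: ler_wpM2l => //.
by rewrite sqr_ge0.
Qed.

(** For Re a >= 0 the operator (1 + aJ)'(1 + aJ) = 1 + 2 Re a J + |a|^2 J^2 has
    nonnegative coefficients, so that bounds for the forms of the powers of J
    are inherited by it. *)
Lemma form_pencil a j x : re (iter j J (pencil a x)) (pencil a x) =
  re (iter j J x) x + 2 * complex.Re a * re (iter j.+1 J x) x
  + complex.Re (`|a| ^+ 2) * re (iter j.+2 J x) x.
Proof.
have real k u : ip (iter k J u) u = (re (iter k J u) u)%:C.
  have := ipC (iter k J u) u; rewrite -(iter_self _ _ _ sJ) /re.
  case: (ip _ _) => s t [] h; congr (_ +i* _); lra.
rewrite {1}/re /pencil (linear_mapD _ _ (iter_linear _ lJ)).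
rewrite (linear_mapZ _ _ (iter_linear _ lJ)).
rewrite !ipDl !ipDr !ipZl !ipZr -iterSr.
have -> : ip (iter j J x) (J x) = ip (iter j.+1 J x) x by rewrite -sJ.
have -> : ip (iter j.+1 J x) (J x) = ip (iter j.+2 J x) x by rewrite -sJ.
rewrite !real mulrA -normCK -add_Re2_Im2.
case: a => s t /=; ring.
Qed.

Lemma form_pencil_iter c L a n j x : 0 <= complex.Re a ->
  (forall j x, re (iter j J (L x)) (L x) <= c * re (iter j J x) x) ->
  re (iter j J (iter n (pencil a) (L x))) (iter n (pencil a) (L x)) <=
  c * re (iter j J (iter n (pencil a) x)) (iter n (pencil a) x).
Proof.
move=> a0 hL; elim: n j => [|n IH] j /=; first exact: hL.
rewrite !form_pencil !mulrDr; apply: lerD; first apply: lerD => //.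
  rewrite mulrCA; apply: ler_wpM2l (IH _).
  by rewrite mulr_ge0.
rewrite mulrCA; apply: ler_wpM2l (IH _).
by rewrite -ler0c RRe_real ?exprn_ge0 // ger0_real // exprn_ge0.
Qed.

Lemma pencil_poly L n m x y : linear_map L -> exists p : {poly R[i]},
  [/\ forall a, ip (iter n (pencil a) (L (iter m (pencil (- a)) x))) y = p.[a],
      p`_0 = ip (L x) y & p`_1 = n%:R * ip (J (L x)) y - m%:R * ip (L (J x)) y].
Proof.
move=> lL; elim: n y => [|n IH] y.
  elim: m x => [|m IH] x.
    exists (ip (L x) y)%:P; split=> [a|//|]; first by rewrite hornerC.
      by rewrite coefC.
    by rewrite coefC /= !mul0r subrr.
  have [p [hp p0 p1]] := IH x; have [q [hq q0 q1]] := IH (J x).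
  exists (p - 'X * q); split.
  - move=> a; have lW := iter_linear m (pencil_linear (- a)).
    move: (hp a) (hq a) lW; rewrite iterSr /=; set W := iter m _ => hpa hqa lW.
    have -> : W (pencil (- a) x) = - a *: W (J x) + W x.
      by rewrite /pencil addrC; exact: lW.
    rewrite lL ipDl ipZl hpa hqa hornerD hornerN hornerM hornerX; ring.
  - by rewrite coefB coefXM /= subr0.
  - by rewrite coefB coefXM /= p1 q0 mulrS; ring.
have [p [hp p0 p1]] := IH y; have [q [hq q0 q1]] := IH (J y).
exists (p + 'X * q); split.
- move=> a; rewrite iterS /pencil ipDl ipZl sJ hp hq.
  by rewrite hornerD hornerM hornerX.
- by rewrite coefD coefXM /= addr0.
- by rewrite coefD coefXM /= p1 q0 sJ mulrS; ring.
Qed.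

Lemma exp_bound k : (0 < k)%N ->
  ((1 + (k%:R^-1) ^+ 2) ^+ 2) ^+ (k ^ 2) <= expR 2 :> R.
Proof.
move=> k0; have kC : k%:R != 0 :> R by rewrite pnatr_eq0 -lt0n.
rewrite -exprM mulnC exprM.
have -> : expR 2 = expR 1 ^+ 2 :> R by rewrite -expRM_natl mulr1.
apply: lerXn2r; rewrite ?nnegrE ?expR_ge0 ?exprn_ge0 ?addr_ge0 ?sqr_ge0 //.
have -> : expR 1 = expR ((k%:R^-1) ^+ 2) ^+ (k ^ 2) :> R.
  by rewrite -expRM_natl natrX -exprMn divff // expr1n.
apply: lerXn2r; rewrite ?nnegrE ?expR_ge0 ?addr_ge0 ?sqr_ge0 //.
exact: expR_ge1Dx.
Qed.

(** Rosenblum's argument with (1 + aJ)^n in place of an exponential. The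
    square of the norm of (1 + aJ)^n L (1 - aJ)^n is at most
    c (1 + |a|^2)^(2n): for Re a >= 0 by the bounds for L on the forms of the
    J^j, for Re a < 0 by those for the adjoint. It is a polynomial in a with
    linear coefficient n (J L - L J). Taking |a| = 1/k and n = k^2 in Cauchy's
    estimate, the bound stays below a constant while the coefficient
    contributes k |J L - L J|. *)
Lemma resolvent_commutes c L Ls : 0 < c -> linear_map L ->
  (forall x y, ip (L x) y = ip x (Ls y)) ->
  (forall j x, re (iter j J (L x)) (L x) <= c * re (iter j J x) x) ->
  (forall j x, re (iter j J (Ls x)) (Ls x) <= c * re (iter j J x) x) ->
  forall x, J (L x) = L (J x).
Proof.
move=> c0 lL LsE hL hLs x; apply/eqP; rewrite -subr_eq0; apply/eqP.
set d := J (L x) - L (J x).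
suff key y : ip d y = 0 by apply: sq_eq0; rewrite /sq /re key.
pose B := c * expR 2 * (sq x + sq y) + sq x + sq y.
have fin k : (0 < k)%N -> `|ip d y| * k%:R <= B%:C.
  move=> k0; pose r : R := k%:R^-1; have r0 : 0 < r by rewrite invr_gt0 ltr0n.
  pose n := (k ^ 2)%N.
  have [p [hp p0 p1]] := pencil_poly n n x y lL.
  have bnd a : `|a| = r%:C -> `|p.[a]| <= B%:C.
    move=> ar; rewrite -hp.
    have E2 := exp_bound k0; rewrite -/r -/n in E2.
    have S u : c * sq (iter n (pencil a) (iter n (pencil (- a)) u)) <=
        c * expR 2 * sq u.
      rewrite -mulrA ler_pM2l //; apply: le_trans (sq_pencilN_iter n u r0 ar) _.
      by rewrite ler_wpM2r ?sq_ge0.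
    have c2 u : 0 <= c * expR 2 * sq u by rewrite !mulr_ge0 ?expR_ge0 ?sq_ge0 // ltW.
    have [ra|ra] := leP 0 (complex.Re a).
      apply: le_trans (norm_ip_le _ _) _; rewrite lecR.
      have := form_pencil_iter n 0 (iter n (pencil (- a)) x) ra hL.
      rewrite /= -!/(sq _) => h.
      have := le_trans h (S x); have := c2 y; have := sq_ge0 x; rewrite /B; lra.
    (* the adjoint exchanges a with - a^*, whose real part is positive *)
    rewrite pencil_iter_adj LsE pencil_iter_adj.
    have rb : 0 <= complex.Re (- a^*) by case: (a) ra => s t /= ra; lra.
    have br : `|- a^*| = r%:C by rewrite normrN norm_conjC.
    have -> : (- a)^* = - a^* by rewrite rmorphN.
    apply: le_trans (norm_ip_le _ _) _; rewrite lecR.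
    have := form_pencil_iter n 0 (iter n (pencil (- - a^*)) y) rb hLs.
    rewrite /= -!/(sq _) => h.
    have := sq_pencilN_iter n y r0 br => h2.
    have h3 : c * sq (iter n (pencil (- a^*)) (iter n (pencil (- - a^*)) y)) <=
        c * expR 2 * sq y.
      by rewrite -mulrA ler_pM2l //; apply: le_trans h2 _; rewrite ler_wpM2r ?sq_ge0.
    rewrite opprK in h h3.
    have := le_trans h h3; have := c2 x; have := sq_ge0 y; rewrite /B; lra.
  have := coef1_bound r0 bnd; rewrite p1 -mulrBr -ipBl -/d normrM normr_nat /r.
  rewrite fmorphV rmorph_nat /n natrX expr2 [X in X <= _](_ : _ = `|ip d y| * k%:R) //.
  by field; rewrite pnatr_eq0 -lt0n.
apply/eqP; rewrite -normr_eq0.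
have uE : `|ip d y| = (complex.Re `|ip d y|)%:C by rewrite RRe_real // ger0_real.
have u0 : 0 <= complex.Re `|ip d y| by rewrite -ler0c -uE.
rewrite uE in fin *; move: (complex.Re _) u0 fin => u u0 fin.
suff -> : u = 0 by [].
apply/eqP; apply: contraT => un; have {un}u0 : 0 < u by rewrite lt_neqAle eq_sym un.
have B0 : 0 <= B / u.
  rewrite divr_ge0 ?(ltW u0) // /B !addr_ge0 ?mulr_ge0 ?expR_ge0 ?sq_ge0 //.
    exact: ltW.
  by rewrite addr_ge0 ?sq_ge0.
have := fin (Num.bound (B / u)).+1 isT.
rewrite -(rmorph_nat (real_complex R)) -rmorphM lecR -ler_pdivlMl // leNgt mulrC.
by rewrite (lt_le_trans (archi_boundP B0)) // ler_nat.
Qed.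

End Commutant.

(** * Adjoints of bounded maps *)

Section BoundedAdjoint.
Context {R : realType} {H : hilbertType R}.
Implicit Types (x y z u v w : H) (c e : R).
Local Notation ip := (inner H).

(** Riesz representation of the functional x |-> (L x, y) by a vector
    orthogonal to its kernel. *)
Lemma bounded_adjoint c (L : H -> H) : 0 < c -> linear_map L -> bounded_map c L ->
  exists Ls, forall x y, ip (L x) y = ip x (Ls y).
Proof.
move=> c0 lL bL.
suff /choice[Ls hLs] : forall y, exists z, forall x, ip (L x) y = ip x z.
  by exists Ls.
move=> y; pose G : set (H * H) := [set p | ip (L p.1) y = 0 /\ p.2 = 0].
have lG : linear_subspace G.
  apply/linear_subspaceP; split=> [|a [u1 u2] [v1 v2] [/= h1 ->] [/= h2 ->]].
    by split=> //=; rewrite (linear_map0 lL) ip0l.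
  by split=> /=; rewrite ?lL ?ipDl ?ipZl ?h1 ?h2 ?scaler0 ?mulr0 addr0.
have cG : closed G.
  apply/closure_id/seteqP; split; first exact: subset_closure.
  move=> [x x'] /closureP cl.
  have small w : (forall u, ip (L u) y = 0 -> re w (L u) = 0) -> re w (L x) = 0.
    move=> hw; apply: re_small => e e0.
    have [[u u'] /= [[/= Lu _] xu _]] := cl _ (divr_gt0 e0 c0).
    exists (L x - L u); first by rewrite reBr (hw _ Lu) subr0.
    by rewrite -linear_mapB //; apply: le_lt_trans (bL _) _; rewrite mulrC -ltr_pdivlMr.
  split=> /=.
    apply/eqP; rewrite eq_complex -/(re _ _) im_re /= reC (reC _ ('i *: y)).
    apply/andP; split; apply/eqP; apply: small => u Lu; first by rewrite reC /re Lu.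
    by rewrite reC -im_re Lu.
  apply: sq_le0; apply/ler_addgt0Pl => e /cl [[u u'] /= [[/= _ ->] _]].
  by rewrite subr0 addr0 => /ltW.
have [[p Lp]|] := pselect (exists p, ip (L p) y != 0); last first.
  move=> /forallNP all0; exists 0 => x; rewrite ip0r.
  by apply/eqP; have /negP := all0 x; rewrite negbK.
have [u [v [[/= Lu _] o]]] := projection p 0 cG lG; set w := p - u in o.
have Lw : ip (L w) y = ip (L p) y by rewrite /w linear_mapB // ipBl Lu subr0.
have ow x : ip (L x) y = 0 -> ip x w = 0.
  move=> Lx; rewrite -(ip0l w).
  apply: ip_reP => a; rewrite scaler0 re0l reC.
  have := o (a *: x) 0; rewrite re0r addr0; apply; split=> //=.
  by rewrite linear_mapZ // ipZl Lx mulr0.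
have w0 : ip w w != 0.
  apply: contra Lp => /eqP; rewrite ip_sq => /(@complexI R _ 0)/sq_eq0 wz.
  by rewrite -Lw wz (linear_map0 lL) ip0l.
exists (((ip (L w) y) / ip w w)^* *: w) => x; rewrite ipZr conjCK.
have Lw0 : ip (L w) y != 0 by rewrite Lw.
clearbody w.
have := ow (x - (ip (L x) y / ip (L w) y) *: w).
rewrite linear_mapB // linear_mapZ // !ipBl !ipZl divfK // subrr => /(_ erefl)/eqP.
rewrite subr_eq0 => /eqP ->.
field; exact/andP.
Qed.

End BoundedAdjoint.

(** * Sums of commuting normal operators *)

Section CommutingSum.
Context {R : realType} {H : hilbertType R}.
Implicit Types (x y z u v w : H) (c e : R) (S T : set (H * H)).
Local Notation ip := (inner H).

Lemma commutes_adj (L Ls : H -> H) T : (forall x y, ip (L x) y = ip x (Ls y)) ->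
  commutes L T -> commutes Ls (adj T).
Proof.
by move=> LsE cL u v Auv x y Txy; rewrite /= -!LsE (Auv _ _ (cL _ _ Txy)).
Qed.

Lemma adj_add S T x u v : adj S (x, u) -> adj T (x, v) -> adj (add_op S T) (x, u + v).
Proof.
move=> hS hT y z [s [t [/= Ss Tt ->]]].
by rewrite /= ipDl ipDr (hS _ _ Ss) (hT _ _ Tt).
Qed.

Lemma add_linear S T : linear_subspace S -> linear_subspace T ->
  linear_subspace (add_op S T).
Proof.
move=> lS lT; apply/linear_subspaceP; split.
  by exists 0, 0; split; rewrite ?addr0 //; exact: lin0.
move=> a [x x'] [y y'] [s [t [/= Sx Tx ->]]] [s' [t' [/= Sy Ty ->]]].
exists (a *: s + s'), (a *: t + t'); split => /=.
- by apply: linD => //; exact: linZ.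
- by apply: linD => //; exact: linZ.
- by rewrite scalerDr addrACA.
Qed.

Variables (A B : set (H * H)) (hA : prenormal A) (hB : prenormal B).
Variables (C Cs : H -> H) (c : R).
Hypothesis (c0 : 0 < c) (lC : linear_map C) (bC : bounded_map c C).
Hypothesis BE : forall u v, B (u, v) <-> u = C v.
Hypothesis CsE : forall x y, ip (C x) y = ip x (Cs y).
Hypothesis hAB : comp_op A (adj B) = comp_op (adj B) A.

Let lA : linear_subspace A. Proof. by case: hA. Qed.
Let lB : linear_subspace B. Proof. by case: hB. Qed.
Let fA : functional A. Proof. by case: hA. Qed.
Let fB : functional B. Proof. by case: hB. Qed.
Let laA : linear_subspace (adj A). Proof. exact: adj_linear. Qed.
Let laB : linear_subspace (adj B). Proof. exact: adj_linear. Qed.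
Let faA : functional (adj A). Proof. by case: hA. Qed.
Let faB : functional (adj B). Proof. by case: hB. Qed.

Local Notation S := (add_op A B).

Lemma CE x y : ip (Cs x) y = ip x (C y).
Proof. by rewrite ipC -CsE -ipC. Qed.

Lemma inverse_graph v : B (C v, v). Proof. exact/BE. Qed.

Lemma adj_inverseP z y : adj B (z, y) <-> z = Cs y.
Proof.
have h : adj B (Cs y, y) by move=> u v /BE -> /=; rewrite -CsE.
split=> [Bz|->//]; have := linB laB Bz h; rewrite subrr => hd.
apply/eqP; rewrite -subr_eq0; apply/eqP/sq_eq0.
by rewrite /sq /re (hd _ _ (inverse_graph _)) /= ip0r.
Qed.

Lemma adj_inverse_linear : linear_map Cs.
Proof.
move=> a x y; apply/esym/adj_inverseP.
by apply: (linD laB); [apply: (linZ laB)|]; apply/adj_inverseP.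
Qed.

Lemma adj_inverse_bounded : bounded_map c Cs.
Proof.
move=> y; have cV : 0 < c^-1 by rewrite invr_gt0.
have h : sq (Cs y) = re (C (Cs y)) y by rewrite /re CsE.
have := young (C (Cs y)) y cV; rewrite invrK -h.
have := bC (Cs y); rewrite -ler_pdivrMl //; lra.
Qed.

Lemma inverse_normal x : C (Cs x) = Cs (C x).
Proof.
have : comp_op (adj B) B (C (Cs x), x).
  by exists (Cs x); [exact/BE|exact/adj_inverseP].
case: hB => _ _ _ _ <- [w /= /adj_inverseP CCs /BE wE].
by rewrite CCs wE.
Qed.

Lemma adj_inverse_commutes : commutes Cs A.
Proof.
move=> x x' Ax; have : comp_op A (adj B) (Cs x, x').
  by exists x => //; exact/adj_inverseP.
by rewrite hAB => -[w /= Aw /adj_inverseP <-].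
Qed.

Lemma inverse_commutes_adj : commutes C (adj A).
Proof. exact: commutes_adj CE adj_inverse_commutes. Qed.

Section Smoothing.
Variables (J : H -> H) (hJ : resolves A J).

Let lJ := resolves_linear hA hJ.
Let sJ := resolves_self hJ.

(** Fuglede's theorem. The hypothesis only makes the adjoint Cs of the inverse
    commute with A, and C with the adjoint of A; the resolvent of A is also
    that of its adjoint, so both C and Cs satisfy the bounds needed to commute
    with it. *)
Lemma inverse_resolvent_comm x : J (C x) = C (J x).
Proof.
apply: (resolvent_commutes lJ sJ (resolves_contraction hA hJ) c0 lC CsE) => j y.
  apply: (resolvent_power_bound hA hJ _ _ c0 adj_inverse_linear adj_inverse_bounded) CE.
  exact: adj_inverse_commutes.
apply: (resolvent_power_bound (prenormal_adj hA) (resolves_adj hA hJ) _ _ c0 lC bC) CsE.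
exact: inverse_commutes_adj.
Qed.

Lemma adj_inverse_resolvent_comm x : J (Cs x) = Cs (J x).
Proof.
apply/eqP; rewrite -subr_eq0; apply/eqP/sq_eq0; set d := J _ - _.
suff : ip d d = 0 by rewrite /sq /re => ->.
by rewrite {1}/d ipBl sJ CE -inverse_resolvent_comm -sJ -CE subrr.
Qed.

(** Let d be the commutator of A and C at J x. As C commutes with A'A and with
    A', the vector d lies in the kernel of A', which is that of A and is
    invariant under Cs. On the other hand d is the difference of a vector of
    the range of A and of the image under C of another such vector, and both
    are orthogonal to this kernel. *)
Lemma inverse_commutes_range x v : A (J x, v) -> A (J (C x), C v).
Proof.
move=> Av; have [v' [Av' aAv]] := hJ x; rewrite -(fA Av Av') in aAv.
have [w [Aw aAw]] := hJ (C x).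
suff <- : w = C v by [].
have := linB laA aAw (inverse_commutes_adj aAv).
rewrite inverse_resolvent_comm -(linear_mapB _ _ lC) subrr; set d := w - C v => aAd.
have ker0 u : A (u, 0) <-> adj A (u, 0).
  split=> [/(prenormal_sq hA)|/(prenormal_sqV hA)] [z]; rewrite sq0 => -[h /sq_eq0 zE];
    by rewrite zE in h.
have aACd : adj A (Cs d, 0).
  apply/ker0; rewrite -(linear_map0 adj_inverse_linear).
  exact/adj_inverse_commutes/ker0.
apply/eqP; rewrite -subr_eq0; apply/eqP/sq_eq0.
suff : ip d d = 0 by rewrite /sq /re => ->.
by rewrite {1}/d ipBl (aAd _ _ Aw) CsE (aACd _ _ Av) /= !ip0r subrr.
Qed.

(** This is (1 + A'A)^-1 (B'B)^-1. It is built from operators that commute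
    with A and B, and its range consists of vectors to which A or B, and then
    A' or B', can be applied. *)
Definition smoothing x := J (C (Cs x)).

Lemma smoothing_self x y : ip (smoothing x) y = ip x (smoothing y).
Proof.
by rewrite /smoothing sJ CsE CE inverse_resolvent_comm adj_inverse_resolvent_comm.
Qed.

Lemma smoothing_inj x : smoothing x = 0 -> x = 0.
Proof.
move=> /(resolves_inj hA hJ) h; have := inverse_graph (Cs x); rewrite h.
move=> /(fB (lin0 lB)) /esym h'.
have /adj_inverseP : Cs x = Cs x by [].
by rewrite h' => /(faB (lin0 laB)).
Qed.

Lemma smoothing_commutes_sum : commutes smoothing S.
Proof.
move=> x _ [s [t [/= As Bt ->]]]; exists (smoothing s), (smoothing t); split=> /=.
- rewrite [smoothing s]/smoothing inverse_resolvent_comm.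
  apply: inverse_commutes_range.
  exact: (resolves_commutes hA hJ (adj_inverse_commutes As)).
- move/BE : Bt => ->; apply/BE; rewrite /smoothing.
  by rewrite -inverse_normal inverse_resolvent_comm.
- rewrite /smoothing -(linear_mapD _ _ lJ) -(linear_mapD _ _ lC).
  by rewrite -(linear_mapD _ _ adj_inverse_linear).
Qed.

Lemma smoothing_range y : exists s t, S (smoothing y, s) /\ adj S (s, t).
Proof.
have [v [Av _]] := hJ (Cs y).
have AQ := inverse_commutes_range Av; rewrite -/(smoothing y) in AQ.
have [w [Aw aAw]] := hJ (C (Cs y)); rewrite (fA Aw AQ) in aAw.
have [w2 [aBw _]] := prenormal_sq hB (inverse_graph v).
have [w3 [aAg _]] := prenormal_sq hA Av.
have aBg : adj B (J (Cs y), J y).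
  by apply/adj_inverseP; exact: adj_inverse_resolvent_comm.
have BQ : B (smoothing y, J (Cs y)) by apply/BE; exact: inverse_resolvent_comm.
exists (C v + J (Cs y)); eexists; split; first by exists (C v), (J (Cs y)).
by apply: adj_add; [exact: linD aAw aAg|exact: linD aBw aBg].
Qed.

(** With Q = smoothing and z = Q y, apply the hypothesis to Q z: since Q commutes
    with S'S it gives 0 = (z + S'S z, z) = |z|^2 + |S z|^2. *)
Lemma total_of_resolvent y :
  (forall x s t, S (x, s) -> adj S (s, t) -> re (x + t) y = 0) -> y = 0.
Proof.
move=> h; have [s [t [Ss aSt]]] := smoothing_range y.
have cQ := smoothing_commutes_sum.
have cQa : commutes smoothing (adj S) := commutes_adj smoothing_self cQ.
have E u : re (smoothing u) y = re u (smoothing y) by rewrite /re smoothing_self.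
have := h _ _ _ (cQ _ _ Ss) (cQa _ _ aSt); rewrite reDl (E (smoothing y)) (E t).
have -> : re t (smoothing y) = sq s.
  by rewrite reC /sq /re (aSt _ _ Ss).
rewrite -/(sq (smoothing y)) => hs; apply: smoothing_inj; apply: sq_le0.
by have := sq_ge0 s; lra.
Qed.

End Smoothing.

Lemma range_one_plus_total y :
  (forall x s t, S (x, s) -> adj S (s, t) -> re (x + t) y = 0) -> y = 0.
Proof.
case: (hA) => _ cA _ _ _; have [J hJ] := exists_resolves cA lA.
exact: total_of_resolvent hJ y.
Qed.

Variable D : set H.
Hypothesis (lD : linear_subspace D) (dD : dense D).
Hypothesis (hDAA : D `<=` dom (comp_op (adj A) A))
    (hDBA : D `<=` dom (comp_op (adj B) A))
    (hDAB : D `<=` dom (comp_op (adj A) B))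
    (hDBB : D `<=` dom (comp_op (adj B) B)).
Hypothesis hcore : comp_op (adj S) S `<=` closure (restr_op (comp_op (adj S) S) D).

(** On D all four products can be exchanged: A'A = AA' and B'B = BB' by
    normality, B'A = AB' by hypothesis, and A'B is contained in BA' because
    the inverse of B commutes with A'. *)
Lemma sum_on_D x : D x -> exists s s' t,
  [/\ S (x, s), adj S (x, s'), adj S (s, t) & S (s', t)].
Proof.
move=> Dx.
have [[x_ p] [x1 /= Ax1 aAp] /= xE] := hDAA Dx; rewrite {x_}xE in Ax1.
have [[x_ x2] [x1' /= Ax1' aBx2] /= xE] := hDBA Dx; rewrite {x_}xE in Ax1'.
rewrite -(fA Ax1 Ax1') in aBx2.
have [[x_ y2] [y1 /= By1 aAy2] /= xE] := hDAB Dx; rewrite {x_}xE in By1.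
have [[x_ q] [y1' /= By1' aBq] /= xE] := hDBB Dx; rewrite {x_}xE in By1'.
rewrite -(fB By1 By1') in aBq.
have : comp_op (adj B) A (x, x2) by exists x1.
rewrite -hAB => -[b /= aBb Abx2].
have : comp_op (adj A) A (x, p) by exists x1.
case: (hA) => _ _ _ _ <- [a /= aAa Aap].
have : comp_op (adj B) B (x, q) by exists y1.
case: (hB) => _ _ _ _ <- [b' /= aBb' Bbq]; rewrite (faB aBb' aBb) in Bbq.
have Bay2 : B (a, y2).
  apply/BE; apply: faA aAa _; move/BE : By1 => ->.
  exact: inverse_commutes_adj.
exists (x1 + y1), (a + b), (p + y2 + (x2 + q)); split.
- by exists x1, y1.
- exact: adj_add.
- by apply: adj_add; [exact: linD aAp aAy2|exact: linD aBx2 aBq].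
- exists (p + x2), (y2 + q); split=> /=; last by rewrite addrACA.
    exact: linD Aap Abx2.
  exact: linD Bay2 Bbq.
Qed.

Let lS : linear_subspace S. Proof. exact: add_linear. Qed.
Let laS : linear_subspace (adj S). Proof. exact: adj_linear. Qed.

Lemma sum_functional : functional S.
Proof.
move=> x y z [s [t [/= As Bt ->]]] [s' [t' [/= As' Bt' ->]]].
by rewrite (fA As As') (fB Bt Bt').
Qed.

Lemma dense_sub (E : set H) : D `<=` E -> dense E.
Proof.
move=> DE O Oo oO; have [z [Oz Dz]] := dD Oo oO.
by exists z; split=> //; exact: DE.
Qed.

Lemma sum_adj_functional : functional (adj S).
Proof.
apply/adj_functional/dense_sub => x /sum_on_D[s [s' [t [Ss _ _ _]]]].
by exists (x, s).
Qed.

Lemma sum_biadj_functional : functional (adj (adj S)).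
Proof.
apply/adj_functional/dense_sub => x /sum_on_D[s [s' [t [_ Ss _ _]]]].
by exists (x, s').
Qed.

Lemma range_on_D_total y :
  (forall x s t, D x -> S (x, s) -> adj S (s, t) -> re (x + t) y = 0) -> y = 0.
Proof.
move=> h; apply: range_one_plus_total => x s t Ss aSt; rewrite reC.
apply: re_small => e e0; have e4 : 0 < e / 4 by lra.
have /closureP/(_ _ e4) : closure (restr_op (comp_op (adj S) S) D) (x, t).
  by apply: hcore; exists s.
move=> [[x' t'] /= [[[s' /= Ss' aSt'] /= Dx'] xx' tt']].
exists ((x - x') + (t - t')).
  rewrite addrACA -opprD reBr [X in _ - X]reC (h _ _ _ Dx' Ss' aSt'); lra.
by apply: le_lt_trans (sqD_le _ _) _; lra.
Qed.

Lemma restr_linear T : linear_subspace T -> linear_subspace (restr_op T D).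
Proof.
move=> lT; have [D0 Dl] := (linear_subspaceP _).1 lD.
apply/linear_subspaceP; split; first by split=> //; exact: lin0.
move=> a [u u'] [v v'] [/= Tu Du] [/= Tv Dv]; split; last exact: Dl.
by apply: linD => //; exact: linZ.
Qed.

(** If (x, y) in the biadjoint is orthogonal to (u, S u) for all u in D, then x
    is orthogonal to u + S'S u. *)
Lemma closure_sum_on_D : closure (restr_op S D) = adj (adj S).
Proof.
have cS : closed (adj (adj S)) by exact: adj_closed.
have sub : closure (restr_op S D) `<=` adj (adj S).
  move=> q cq; apply: closed_mem => //; apply: closureS cq => r [Sr _]; exact: adjI.
apply/seteqP; split=> // p Sp.
apply: mem_closed (Sp) _ => //; [exact: closed_closure| | |].
- exact/linear_closure/restr_linear.
- exact: adj_linear.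
move=> x y Sxy o; have x0 : x = 0.
  apply: range_on_D_total => u s t Du Su aSt.
  have := o u s (subset_closure _); rewrite reC reDl => /(_ (conj Su Du)).
  have /adjP-/(_ laS)/(_ _ _ aSt) /= -> := Sxy; rewrite (reC y); lra.
split=> //; rewrite x0 in Sxy; apply: sum_biadj_functional Sxy (lin0 _).
exact: adj_linear.
Qed.

(** The same argument applies to the adjoint, because S S' u = S'S u on D. *)
Lemma closure_adj_on_D : adj S `<=` closure (restr_op (adj S) D).
Proof.
move=> p Sp; apply: mem_closed (Sp) _ => //; [exact: closed_closure| | |].
- exact/linear_closure/restr_linear.
- move=> q cq; apply: closed_mem; first exact: adj_closed.
  by apply: closureS cq => r [].
move=> x y Sxy o; have x0 : x = 0.
  apply: range_on_D_total => u s t Du Su aSt.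
  have [s1 [s' [t1 [Su1 aSu aSt1 Ss']]]] := sum_on_D Du.
  rewrite (sum_functional Su Su1) in aSt; rewrite (sum_adj_functional aSt aSt1).
  have := o u s' (subset_closure _); rewrite reC reDl => /(_ (conj aSu Du)).
  have /adjP-/(_ lS)/(_ _ _ Ss') /= := Sxy; rewrite (reC y); lra.
by split=> //; rewrite x0 in Sxy; apply: sum_adj_functional Sxy (lin0 _).
Qed.

Lemma sum_normal_on : essentially_normal_on S D.
Proof.
have V := restr_linear lS; have cE := closure_sum_on_D.
have la2 : linear_subspace (adj (adj S)) := @adj_linear _ _ _.
have ca : closed (adj S) := adj_closed lS.
have eqsq u s s' t : S (u, s) -> adj S (u, s') -> adj S (s, t) -> S (s', t) ->
    sq s = sq s'.
  move=> Su aSu aSt Ss'; rewrite /sq /re (aSt _ _ Su) /= -/(re u t) reC.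
  by rewrite /re (aSu _ _ Ss').
have opN : is_operator (closure (restr_op S D)).
  by rewrite cE; split=> //; exact: sum_biadj_functional.
have dV : densely_defined (restr_op S D).
  apply: dense_sub => x Dx; have [s [_ [_ [Ss _ _ _]]]] := sum_on_D Dx.
  by exists (x, s).
split=> // [x|].
  by move=> /sum_on_D[s [_ [_ [Ss _ _ _]]]]; exists (x, s).
split=> //.
  by split=> // x y z [Sy _] [Sz _]; exact: sum_functional Sy Sz.
apply: normal_of_isometric => //.
- apply: dense_sub => x Dx; have [s [_ [_ [Ss _ _ _]]]] := sum_on_D Dx.
  by exists (x, s) => //; apply: subset_closure.
- exact: closed_closure.
- move=> x y; rewrite {2}cE adjK // => cl.
  have [|z hz] := closure_transfer V laS ca _ sum_adj_functional cl; last by exists z.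
  move=> u s [/= Su Du].
  have [s1 [s' [t [Su1 aSu aSt Ss']]]] := sum_on_D Du.
  exists s'; split=> //.
  by rewrite (sum_functional Su Su1) (eqsq _ _ _ _ Su1 aSu aSt Ss').
- move=> x y; rewrite cE adjK // => /closure_adj_on_D cl.
  have cla2 : closed (adj (adj S)) := adj_closed laS.
  have [|z [Sz _]] :=
    closure_transfer (restr_linear laS) la2 cla2 _ sum_biadj_functional cl;
    last by exists z.
  move=> u s' [/= aSu Du]; have [s [s1 [t [Su aSu1 aSt Ss']]]] := sum_on_D Du.
  exists s; split; first exact: adjI.
  by rewrite (sum_adj_functional aSu aSu1) (eqsq _ _ _ _ Su aSu1 aSt Ss').
Qed.

End CommutingSum.

Theorem proposition1 (R : realType) (H : hilbertType R) (A B : set (H * H))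
    (hA : normal_op A) (hB : normal_op B)
    (hAB : comp_op A (adj B) = comp_op (adj B) A)
    (hBinv : invertible B)
    (D : set H) (hDsub : linear_subspace D) (hDdense : dense D)
    (hDAA : D `<=` dom (comp_op (adj A) A))
    (hDBA : D `<=` dom (comp_op (adj B) A))
    (hDAB : D `<=` dom (comp_op (adj A) B))
    (hDBB : D `<=` dom (comp_op (adj B) B))
    (hcore : is_core (comp_op (adj (add_op A B)) (add_op A B)) D) :
  essentially_normal_on (add_op A B) D.
Proof.
have [f [[M fM] BE]] := hBinv.
(* M may vanish, whereas a positive bound is needed *)
have c0 : 0 < M ^+ 2 + 1 by rewrite ltr_wpDl // sqr_ge0.
have lf : linear_map f by move=> a x y; exact: linearP.
have bf : bounded_map (M ^+ 2 + 1) f.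
  move=> x; rewrite -lecR rmorphM /= !sq_norm.
  apply: le_trans (_ : (M%:C * `|x|) ^+ 2 <= _).
    by rewrite lerXn2r ?nnegrE //; apply: le_trans (fM x).
  by rewrite exprMn ler_wpM2r ?exprn_ge0 // -rmorphXn lecR lerDl.
have [g fg] := bounded_adjoint c0 lf bf.
have BE' u v : B (u, v) <-> u = f v.
  by have /(congr1 (@^~ (v, u))) /= := BE => /= ->.
have hN := sum_normal_on (normal_prenormal hA) (normal_prenormal hB) c0 lf bf BE' fg.
apply: hN => //.
by case: hcore => _ _ _ _ ->; exact: subset_closure.
Qed.
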